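(* Let $\mu,\nu$ be any macro states and define $M_{\mu\nu}:=\frac1{d_\mu}\sum_{e\in\mathcal{E}}\operatorname{tr}(P_\mu\Pi_eP_\nu\Pi_e)$. Then for any $\varepsilon,\delta>0$, $(1-\varepsilon)$-most $\psi_0\in\mathbb{S}(\mathcal{H}_\mu)$ are such that for $(1-\delta)$-most $t\in[0,\infty)$, $$\Bigl|\|P_\nu\psi_t\|^2-M_{\mu\nu}\Bigr|\le 4\sqrt{\frac{D_ED_G}{\delta\varepsilon d_\mu}\min\Bigl\{1,\frac{d_\nu}{d_\mu}\Bigr\}}.$$
   Context: $\mathcal{H}$ is a finite-dimensional complex Hilbert space with an orthogonal decomposition $\mathcal{H}=\bigoplus_\nu\mathcal{H}_\nu$ into nonzero subspaces (macro spaces); $P_\nu$ is the orthogonal projection onto $\mathcal{H}_\nu$, $d_\nu=\dim\mathcal{H}_\nu$. $H$ is a self-adjoint operator on $\mathcal{H}$ with spectral decomposition $H=\sum_{e\in\mathcal{E}}e\,\Pi_e$, where $\mathcal{E}$ is the set of distinct eigenvalues and $\Pi_e$ the eigenprojection; $\psi_t=e^{-iHt}\psi_0$. $D_E:=\max_{e\in\mathcal{E}}\operatorname{tr}\Pi_e$ (maximal degeneracy) and $D_G:=\max_{E\in\mathbb{R}}\#\{(e,e')\in\mathcal{E}\times\mathcal{E}: e\ne e',\ e-e'=E\}$ (maximal gap degeneracy). $u_\mu$ is the normalized uniform measure on the unit sphere $\mathbb{S}(\mathcal{H}_\mu)$; ''$s(\psi)$ holds for $(1-\varepsilon)$-most $\psi\in\mathbb{S}(\mathcal{H}_\mu)$''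 means $u_\mu(\{\psi:s(\psi)\})\ge1-\varepsilon$. ''$s(t)$ holds for $(1-\delta)$-most $t\in[0,\infty)$'' means $\liminf_{T\to\infty}\frac1T|\{t\in[0,T]:s(t)\}|\ge1-\delta$, with $|\cdot|$ Lebesgue measure. *)

(* Defs.v *)
From HB Require Import structures.
From mathcomp Require Import all_boot all_order all_algebra.
From mathcomp Require Import all_classical all_reals all_analysis.
From mathcomp.real_closed Require Import complex.

Set Implicit Arguments.
Unset Strict Implicit.
Unset Printing Implicit Defensive.

Import Order.TTheory GRing.Theory Num.Theory.
Import numFieldNormedType.Exports numFieldTopology.Exports.
Local Open Scope ring_scope.
Local Open Scope classical_set_scope.

Definition adjmx (R : rcfType) (m n : nat) (A : 'M[R[i]]_(m, n)) : 'M[R[i]]_(n, m) :=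
  (map_mx (@conjc R) A)^T.

Definition orth_proj (R : rcfType) (n : nat) (Q : 'M[R[i]]_n) : Prop :=
  Q *m Q = Q /\ adjmx Q = Q.

Definition normsq (R : rcfType) (n : nat) (v : 'cV[R[i]]_n) : R :=
  \sum_(i < n) ((complex.Re (v i 0)) ^+ 2 + (complex.Im (v i 0)) ^+ 2).

Definition macro_decomposition (R : rcfType) (n k : nat) (P : 'I_k -> 'M[R[i]]_n) : Prop :=
  [/\ forall nu, orth_proj (P nu),
      forall nu, P nu != 0,
      forall nu nu', nu != nu' -> P nu *m P nu' = 0
    & \sum_(nu < k) P nu = 1%:M].

Definition spectral_decomposition (R : rcfType) (n : nat) (H : 'M[R[i]]_n)
    (E : seq R) (Pi : R -> 'M[R[i]]_n) : Prop :=
  [/\ adjmx H = H /\ uniq E,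
      forall e, e \in E -> orth_proj (Pi e) /\ Pi e != 0,
      forall e e', e \in E -> e' \in E -> e != e' -> Pi e *m Pi e' = 0,
      \sum_(e <- E) Pi e = 1%:M
    & H = \sum_(e <- E) (e%:C)%C *: Pi e].

Definition expi (R : realType) (x : R) : R[i] := (cos x +i* sin x)%C.

(* e^{-iHt} = \sum_e e^{-iet} Pi_e  (functional calculus of H) *)
Definition evol (R : realType) (n : nat) (E : seq R) (Pi : R -> 'M[R[i]]_n) (t : R)
  : 'M[R[i]]_n := \sum_(e <- E) expi (- (e * t)) *: Pi e.

Definition Mcoef (R : rcfType) (n : nat) (E : seq R) (Pi : R -> 'M[R[i]]_n)
    (Pmu Pnu : 'M[R[i]]_n) : R[i] :=
  ((\rank Pmu)%:R)^-1 * \sum_(e <- E) \tr (Pmu *m Pi e *m Pnu *m Pi e).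

Definition DE (R : rcfType) (n : nat) (E : seq R) (Pi : R -> 'M[R[i]]_n) : R :=
  \big[Num.max/0]_(e <- E) complex.Re (\tr (Pi e)).

Definition gap_count (R : rcfType) (E : seq R) (g : R) : nat :=
  count (fun x : R * R => (x.1 != x.2) && (x.1 - x.2 == g)) (allpairs pair E E).

(* D_G = max_{g in R} gap_count g; the max over all real g is attained at a
   difference of two elements of E (any other g gives 0). *)
Definition DG (R : rcfType) (E : seq R) : nat :=
  \max_(g <- [seq x.1 - x.2 | x <- allpairs pair E E]) gap_count E g.

Fixpoint iter_leb (R : realType) (m : nat) (f : seq R -> \bar R) : \bar R :=
  match m with
  | 0 => f [::]
  | m'.+1 => (\int[@lebesgue_measure R]_x iter_leb m' (fun s => f (x :: s)))%E
  end.

Definition cvec_of_coords (R : rcfType) (d : nat) (s : seq R) : 'cV[R[i]]_d :=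
  \col_(j < d) (nth 0 s (2 * j) +i* nth 0 s (2 * j).+1)%C.

Definition cone_vol (R : realType) (n d : nat) (V : 'M[R[i]]_(n, d))
    (A : set 'cV[R[i]]_n) : \bar R :=
  iter_leb (2 * d) (fun s =>
    (\1_[set s' : seq R | let z := cvec_of_coords d s' in
          0 < normsq z <= 1 /\
          A (V *m ((((Num.sqrt (normsq z))^-1)%:C)%C *: z))] s)%:E).

(* Normalized uniform (surface) measure on the unit sphere of the range of
   the isometry V : C^d -> C^n, computed as the normalized cone measure
   u(A) = vol(cone(A)) / vol(unit ball). *)
Definition unif_sphere (R : realType) (n d : nat) (V : 'M[R[i]]_(n, d))
    (A : set 'cV[R[i]]_n) : \bar R :=
  (cone_vol V A * ((fine (cone_vol V setT))^-1)%:E)%E.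

Definition isometry_onto (R : rcfType) (n d : nat) (V : 'M[R[i]]_(n, d))
    (Q : 'M[R[i]]_n) : Prop :=
  adjmx V *m V = 1%:M /\ V *m adjmx V = Q.

Definition most_times (R : realType) (s : R -> Prop) (delta : R) : Prop :=
  ((1 - delta)%:E <=
     limf_einf (fun T : R => (T^-1)%:E * @lebesgue_measure R [set t : R | (0 <= t <= T)%R /\ s t])
               (@pinfty_nbhs R))%E.

(* Main.v *)
Require Import Defs.
From HB Require Import structures.
From mathcomp Require Import all_boot all_order all_algebra.
From mathcomp Require Import all_classical all_reals all_analysis.
From mathcomp Require Import measurable_realfun.
From mathcomp.real_closed Require Import complex.
From mathcomp Require Import ring lra.
Import Order.TTheory GRing.Theory Num.Theory.
Import numFieldNormedType.Exports numFieldTopology.Exports.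
Set Implicit Arguments.
Unset Strict Implicit.
Unset Printing Implicit Defensive.
Local Open Scope ring_scope.
Local Open Scope classical_set_scope.

(* The dynamics gives [f(t) = |P_nu psi_t|^2 - M] as a trigonometric sum whose
   coefficients are quadratic forms in [psi_0]: a constant term, the deviation of
   [sum_e <psi_0, Pi_e P_nu Pi_e psi_0>] from its spherical mean [M], and a term
   [<psi_0, Pi_e P_nu Pi_e' psi_0>] of frequency [e - e'] for every pair [e <> e'].
   The time average of [f^2] is therefore at most the squared constant term plus
   [DG] times the sum of the squared other coefficients.

   The second moment of a quadratic form [A] over the unit sphere of C^d is
   [(|tr A|^2 + ||A||_HS^2) / (d (d + 1))]: the iterated Lebesgue integral is
   invariant under shears, hence under rotations, and the phase rotations together
   with one rational rotation determine all fourth moments. Hilbert-Schmidt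
   contraction estimates then bound the spherical mean of the time average by
   [3 DE DG min(d_mu, d_nu) / (d_mu (d_mu + 1))], and Markov's inequality, once on
   the sphere and once in time, concludes. If [DG = 0] then [H] is scalar and [f]
   vanishes identically. *)

(** * Lebesgue measure on coordinate sequences *)

(** The uniform measure is given by iterated one-dimensional integrals, so its symmetries have to be
    built from translations in one variable and Tonelli exchanges. Parametrizing rotations by the
    tangent [t] of the half-angle keeps their entries rational: [t = 1] is a quarter turn, [t = 1/2]
    the 3-4-5 rotation. Splitting off the constant term pays twice: its matrix is traceless, so only
    a Hilbert-Schmidt norm survives, and its frequency 0 is not a gap, so it carries no factor [DG].
    With [m = min(d_mu, d_nu)] the contributions are [m] from this term, [DG DE m] from the traces
    of the other blocks and [DG m] from their Hilbert-Schmidt norms. Each is at most [DE DG m] as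
    soon as [DE] and [DG] are at least 1; this is the origin of the 3, and the reason for a separate
    case [DG = 0]. The two Markov steps cost [1 / (delta eps)], and [3 / (d (d + 1)) <= 16 / d^2],
    where 16 is the square of the constant 4. *)

Section TranslationInvariance.
Local Open Scope ereal_scope.
Context {R : realType}.
Local Notation leb := (@lebesgue_measure R).

(** The pushforward under the translation gives every half-open interval its length, which
    determines Lebesgue measure. *)
Lemma lebesgue_measureD (c : R) (A : set R) : measurable A ->
  leb ((fun x => x + c)%R @^-1` A) = leb A.
Proof.
move=> mA.
have mc : measurable_fun setT (fun x : measurableTypeR R => x + c : measurableTypeR R)%R.
  exact: measurable_funD.
pose mcX := isMeasurableFun.Build _ _ _ _ _ mc.
pose phi : {mfun measurableTypeR R >-> measurableTypeR R} :=
  HB.pack (fun x : measurableTypeR R => x + c : measurableTypeR R)%R mcX.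
rewrite -[LHS]/(pushforward leb phi A).
apply/esym/lebesgue_measure_unique => //= _ [[a b]] _ <-.
rewrite /pushforward /phi /=.
have -> : ((fun x : R => x + c)%R @^-1` `]a, b]) = `](a - c)%R, (b - c)%R]%classic.
  by apply/seteqP; split=> x /=; rewrite !in_itv/= lerBrDr ltrBlDr.
rewrite !lebesgue_measure_itv/= !lte_fin ltrD2r; case: ifP => // _.
by rewrite -!EFinD; congr EFin; ring.
Qed.

Lemma ge0_integralD_shift (c : R) (f : R -> \bar R) :
  measurable_fun setT f -> (forall x, 0 <= f x) ->
  \int[leb]_x f (x + c)%R = \int[leb]_x f x.
Proof.
move=> mf f0.
have mc : measurable_fun setT (fun x : measurableTypeR R => x + c : measurableTypeR R)%R.
  exact: measurable_funD.
transitivity (\int[pushforward leb (fun x : measurableTypeR R => x + c : measurableTypeR R)%R]_x f x).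
  by rewrite ge0_integral_pushforward.
apply: eq_measure_integral => A mA _; exact: lebesgue_measureD.
Qed.

End TranslationInvariance.

HB.instance Definition _ (T : choiceType) := isPointed.Build (seq T) [::].

(* Sequences of all lengths carry the sigma-algebra generated by the coordinates
   [nth 0 s i]; [leb_seq m] only charges the sequences of length [m]. *)
Definition coord_cylinders (R : realType) : set (set (seq R)) :=
  [set A | exists i (B : set (measurableTypeR R)),
     measurable B /\ A = (fun s => nth 0 s i) @^-1` B].

Notation seqM R := (g_sigma_algebraType (@coord_cylinders R)).

Section IteratedIntegral.
Local Open Scope ereal_scope.
Context {R : realType}.
Local Notation leb := (@lebesgue_measure R).
Implicit Types (f : seqM R -> \bar R) (m : nat).

Lemma measurable_nth_seq i : measurable_fun setT (fun s : seqM R => nth 0%R s i).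
Proof.
move=> _ B mB; rewrite setTI; apply: sub_sigma_algebra.
by exists i, B.
Qed.

Lemma measurable_to_seq d (T : measurableType d) (g : T -> seqM R) :
  (forall i, measurable_fun setT (fun t => nth 0%R (g t) i)) ->
  measurable_fun setT g.
Proof.
move=> mg; refine (@measurability _ _ T (seqM R) setT g (@coord_cylinders R) _ _) => //.
by move=> _ [_ [i [B [mB ->]]] <-]; exact: mg.
Qed.

Lemma measurable_cons_seq d (T : measurableType d) (x : T -> R) (g : T -> seqM R) :
  measurable_fun setT x -> measurable_fun setT g ->
  measurable_fun setT (fun t => x t :: g t : seqM R).
Proof.
move=> mx mg; apply: measurable_to_seq => -[|i] //=.
exact: (measurableT_comp (measurable_nth_seq i) mg).
Qed.

Lemma iter_leb_ge0 m f : (forall s, 0 <= f s) -> 0 <= iter_leb m f.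
Proof.
elim: m f => [|m IH] f f0 //=.
by apply: integral_ge0 => x _; apply: IH.
Qed.

Lemma eq_iter_leb m (f g : seq R -> \bar R) :
  (forall s, size s = m -> f s = g s) -> iter_leb m f = iter_leb m g.
Proof.
elim: m f g => [|m IH] f g fg /=; first exact: fg.
apply: eq_integral => x _; apply: IH => s sm; apply: fg => /=; by rewrite sm.
Qed.

(** Both integrals are suprema over simple functions, so arbitrary functions are allowed; the cone
    volume is later taken of a set of initial states not shown to be measurable. *)
Lemma ge0_le_integralT (f g : R -> \bar R) : (forall x, 0 <= f x) ->
  (forall x, f x <= g x) -> \int[leb]_x f x <= \int[leb]_x g x.
Proof.
move=> f0 fg; have g0 x : 0 <= g x by exact: le_trans (fg x).
rewrite !ge0_integralTE//.
apply: ereal_sup_le => _ [h hf <-]; exists h => // x.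
exact: le_trans (fg x).
Qed.

Lemma le_iter_leb m (f g : seq R -> \bar R) : (forall s, 0 <= f s) ->
  (forall s, f s <= g s) -> iter_leb m f <= iter_leb m g.
Proof.
elim: m f g => [|m IH] f g f0 fg /=; first exact: fg.
by apply: ge0_le_integralT => x; [exact: iter_leb_ge0|exact: IH].
Qed.

(** The parameter space varies in the induction: each step moves the first coordinate of the
    sequence into the parameter, and Tonelli's theorem integrates it out. *)
Lemma measurable_iter_leb m d (T : measurableType d) (F : T * seqM R -> \bar R) :
  measurable_fun setT F -> (forall t, 0 <= F t) ->
  measurable_fun setT (fun t => iter_leb m (fun s => F (t, s))).
Proof.
elim: m d T F => [|m IH] d T F mF F0 /=.
  exact: (measurable_fun_pair1 ([::] : seqM R) mF).
pose G (z : (T * R) * seqM R) := F (z.1.1, z.1.2 :: z.2 : seqM R).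
have mG : measurable_fun setT G.
  apply: (measurableT_comp mF); apply: measurable_fun_pair.
    exact: (measurableT_comp measurable_fst measurable_fst).
  apply: measurable_cons_seq; last exact: measurable_snd.
  exact: (measurableT_comp measurable_snd measurable_fst).
have G0 z : 0 <= G z by exact: F0.
have := IH _ (T * measurableTypeR R)%type G mG G0.
move=> /(measurable_fun_fubini_tonelli_F (m2 := leb)); apply.
by move=> z; exact: iter_leb_ge0.
Qed.

Lemma iter_leb_exchange m (F : R * seqM R -> \bar R) :
  measurable_fun setT F -> (forall t, 0 <= F t) ->
  \int[leb]_x iter_leb m (fun s => F (x, s)) =
  iter_leb m (fun s => \int[leb]_x F (x, s)).
Proof.
elim: m F => [|m IH] F mF F0 //=.
pose G (z : (R * R) * seqM R) := F (z.1.1, z.1.2 :: z.2 : seqM R).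
have mG : measurable_fun setT G.
  apply: (measurableT_comp mF); apply: measurable_fun_pair.
    exact: (measurableT_comp measurable_fst measurable_fst).
  apply: measurable_cons_seq; last exact: measurable_snd.
  exact: (measurableT_comp measurable_snd measurable_fst).
rewrite (@fubini_tonelli _ _ (measurableTypeR R) (measurableTypeR R) R leb leb
  (fun z => iter_leb m (fun s => G (z, s)))); first last.
- by move=> z; apply: iter_leb_ge0 => s; exact: F0.
- by apply: measurable_iter_leb => // z; exact: F0.
apply: eq_integral => y _.
rewrite (IH (fun z => F (z.1, y :: z.2)))//.
apply: (measurableT_comp mF); apply: measurable_fun_pair.
  exact: measurable_fst.
by apply: measurable_cons_seq => //; exact: measurable_snd.
Qed.

Lemma measurable_consP (f : seqM R -> \bar R) x : measurable_fun setT f ->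
  measurable_fun setT (fun s : seqM R => f (x :: s)).
Proof.
by move=> mf; apply: (measurableT_comp mf); exact: measurable_cons_seq.
Qed.

Lemma measurable_set_nth d (T : measurableType d) (x : T -> R) a (g : T -> seqM R) :
  measurable_fun setT x -> measurable_fun setT g ->
  measurable_fun setT (fun t => set_nth 0%R (g t) a (x t) : seqM R).
Proof.
move=> mx mg; apply: measurable_to_seq => i.
under eq_fun do rewrite nth_set_nth /=.
case: (i == a) => //; exact: (measurableT_comp (measurable_nth_seq i)).
Qed.

Lemma iter_leb_translate m a (c : R) f : (a < m)%N ->
  measurable_fun setT f -> (forall s, 0 <= f s) ->
  iter_leb m (fun s => f (set_nth 0%R s a (nth 0%R s a + c)%R)) = iter_leb m f.
Proof.
elim: m a f => // m IH [|a] f am mf f0 /=; last first.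
  apply: eq_integral => x _; apply: (IH a (fun s => f (x :: s))) => //.
  exact: measurable_consP.
apply: (@ge0_integralD_shift R c (fun x => iter_leb m (fun s => f (x :: s)))).
  apply: (@measurable_iter_leb m _ (measurableTypeR R) (fun z => f (z.1 :: z.2))) => //.
  by apply: (measurableT_comp mf); apply: measurable_cons_seq.
by move=> x; exact: iter_leb_ge0.
Qed.

Definition shear (a b : nat) (c : R) (s : seq R) : seq R :=
  set_nth 0%R s a (nth 0%R s a + c * nth 0%R s b)%R.

Lemma nth_shear a b c s i :
  nth 0%R (shear a b c s) i =
  (if i == a then nth 0%R s a + c * nth 0%R s b else nth 0%R s i)%R.
Proof. exact: nth_set_nth. Qed.

Lemma measurable_shear a b c :
  measurable_fun setT (shear a b c : seqM R -> seqM R).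
Proof.
apply: measurable_set_nth => //.
apply: measurable_funD; first exact: measurable_nth_seq.
by apply: measurable_funM => //; exact: measurable_nth_seq.
Qed.

(* Fubini brings the sheared coordinate innermost, where the shear is a translation. *)
Lemma iter_leb_shear m a b c f : (a < m)%N -> (b < m)%N -> a != b ->
  measurable_fun setT f -> (forall s, 0 <= f s) ->
  iter_leb m (fun s => f (shear a b c s)) = iter_leb m f.
Proof.
elim: m a b f => // m IH [|a] [|b] f am bm ab mf f0 //=.
- rewrite (@iter_leb_exchange m (fun z => f ((z.1 + c * nth 0%R z.2 b)%R :: z.2)))//=; last first.
    apply: (measurableT_comp mf); apply: measurable_cons_seq => //.
    apply: measurable_funD => //; apply: measurable_funM => //.
    by apply: (measurableT_comp (measurable_nth_seq b)).
  rewrite (@iter_leb_exchange m (fun z => f (z.1 :: z.2)))//; last first.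
    by apply: (measurableT_comp mf); apply: measurable_cons_seq.
  apply: eq_iter_leb => s _.
  apply: (@ge0_integralD_shift R _ (fun x => f (x :: s))) => //.
  by apply: (measurableT_comp mf); apply: measurable_cons_seq.
- apply: eq_integral => x _.
  by apply: (@iter_leb_translate m a (c * x) (fun s => f (x :: s))) => //; exact: measurable_consP.
- apply: eq_integral => x _.
  by apply: (IH a b (fun s => f (x :: s))) => //; exact: measurable_consP.
Qed.

(** Monotone convergence in one coordinate at a time; this is the countable additivity of
    [leb_seq]. *)
Lemma iter_leb_nneseries m (F : nat -> seqM R -> \bar R) :
  (forall k, measurable_fun setT (F k)) -> (forall k s, 0 <= F k s) ->
  iter_leb m (fun s => \sum_(k <oo) F k s) = \sum_(k <oo) iter_leb m (F k).
Proof.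
elim: m F => [|m IH] F mF F0 //=.
under eq_integral do (rewrite IH//; last by move=> k; exact: measurable_consP).
rewrite integral_nneseries// => [k|k x _]; last exact: iter_leb_ge0.
apply: (@measurable_iter_leb m _ (measurableTypeR R) (fun z => F k (z.1 :: z.2))) => //.
by apply: (measurableT_comp (mF k)); apply: measurable_cons_seq.
Qed.

(** The same iterated integral as in [cone_vol], so that cone volumes become values of a genuine
    measure and integration theory applies to them. *)
Definition leb_seq m (A : set (seqM R)) : \bar R := iter_leb m (fun s => (\1_A s)%:E).

Let leb_seq0 m : leb_seq m set0 = 0.
Proof.
rewrite /leb_seq; elim: m => [|m IH] /=; first by rewrite indicE in_set0.
under eq_integral => x _.
  rewrite (@eq_iter_leb _ _ (fun s => (\1_(set0 : set (seqM R)) s)%:E)); last first.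
    by move=> s _; rewrite !indicE !in_set0.
  rewrite IH; over.
by rewrite integral0.
Qed.

Let leb_seq_ge0 m A : 0 <= leb_seq m A.
Proof. by apply: iter_leb_ge0 => s; rewrite lee_fin. Qed.

Let leb_seq_sigma_additive m : semi_sigma_additive (leb_seq m).
Proof.
move=> F mF tF mUF.
have -> : leb_seq m (\bigcup_n F n) = \sum_(k <oo) leb_seq m (F k).
  rewrite -iter_leb_nneseries; last 2 first.
  - by move=> k; apply/measurable_EFinP; exact: measurable_indic.
  - by move=> k s; rewrite lee_fin.
  rewrite /leb_seq; congr iter_leb; apply/funext => s.
  (* Evaluating indicators at [s] is the Dirac measure at [s]; its additivity expands the indicator
     of the disjoint union into a series. *)
  pose ds : {measure set (seqM R) -> \bar R} := @dirac _ (seqM R) s R.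
  transitivity (ds (\bigcup_n F n)); first by rewrite /ds/= diracE indicE.
  have /cvg_lim <- // := @measure_semi_sigma_additive _ _ _ ds F mF tF mUF.
exact: is_cvg_nneseries.
Qed.

HB.instance Definition _ m := isMeasure.Build _ (seqM R) R (leb_seq m)
  (leb_seq0 m) (leb_seq_ge0 m) (@leb_seq_sigma_additive m).

Lemma leb_seq_shear m a b c (A : set (seqM R)) : (a < m)%N -> (b < m)%N -> a != b ->
  measurable A -> leb_seq m (shear a b c @^-1` A) = leb_seq m A.
Proof.
move=> am bm ab mA; rewrite /leb_seq -[RHS](@iter_leb_shear m a b c)//.
by apply/measurable_EFinP; exact: measurable_indic.
Qed.

End IteratedIntegral.

(** * Rotation invariance and the unit ball *)

Section Rotations.
Context {R : realType}.
Local Notation seqR := (seqM R).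
Implicit Types (s : seqR) (a b i j : nat) (t : R).

(* The rotation of the plane (s_a, s_b) whose half-angle has tangent t,
   written as a product of three shears. *)
Definition rot a b t (s : seqR) : seqR :=
  shear a b (- t) (shear b a (2 * t / (1 + t ^+ 2)) (shear a b (- t) s)).

Lemma nth_rot a b t s i : a != b ->
  nth 0 (rot a b t s) i =
  if i == a then (1 - t ^+ 2) / (1 + t ^+ 2) * nth 0 s a - 2 * t / (1 + t ^+ 2) * nth 0 s b
  else if i == b then 2 * t / (1 + t ^+ 2) * nth 0 s a + (1 - t ^+ 2) / (1 + t ^+ 2) * nth 0 s b
  else nth 0 s i.
Proof.
move=> ab; have t0 : 1 + t ^+ 2 != 0.
  by rewrite gt_eqF// ltr_wpDr// ?sqr_ge0.
rewrite /rot !nth_shear !eqxx (negbTE ab) (eq_sym b) (negbTE ab).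
case: (eqVneq i a) => [_|ia]; first by field.
by case: (eqVneq i b) => [_|ib //]; field.
Qed.

Lemma measurable_rot a b t : measurable_fun setT (rot a b t).
Proof.
apply: (measurableT_comp (measurable_shear a b _)).
apply: (measurableT_comp (measurable_shear b a _)).
exact: measurable_shear.
Qed.

Lemma leb_seq_rot m a b t (A : set seqR) : (a < m)%N -> (b < m)%N -> a != b ->
  measurable A -> leb_seq m (rot a b t @^-1` A) = leb_seq m A.
Proof.
move=> am bm ab mA.
have mpre a' b' c (B : set seqR) : measurable B -> measurable (shear a' b' c @^-1` B : set seqR).
  by move=> mB; rewrite -[X in measurable X]setTI; apply: measurable_shear.
rewrite -(leb_seq_shear (- t) am bm ab mA).
rewrite -(leb_seq_shear (2 * t / (1 + t ^+ 2)) bm am _ (mpre _ _ _ _ mA)) 1?eq_sym//.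
exact: (leb_seq_shear (- t) am bm ab (mpre _ _ _ _ (mpre _ _ _ _ mA))).
Qed.

End Rotations.

(** * Volume of the punctured unit ball *)

Section SphereMoments.
Context {R : realType} (d : nat).
Local Notation seqR := (seqM R).
Local Notation vol := (@leb_seq R (2 * d)).
Implicit Types s : seqR.

Definition zcoord j s : R[i] := (nth 0 s (2 * j) +i* nth 0 s (2 * j).+1)%C.

Definition sqnorm s : R := normsq (cvec_of_coords d s).

Lemma sqnormE s : sqnorm s = \sum_(i < 2 * d) nth 0 s i ^+ 2.
Proof.
rewrite /sqnorm /normsq; under eq_bigr do rewrite mxE /=.
elim: d => [|k IH]; first by rewrite !big_ord0.
by rewrite big_ord_recr/= IH mulnS !big_ord_recr /= addrA.
Qed.

Lemma sqnorm_ge0 s : 0 <= sqnorm s.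
Proof. by rewrite sqnormE; apply: sumr_ge0 => i _; exact: sqr_ge0. Qed.

Lemma measurable_sqnorm : measurable_fun setT sqnorm.
Proof.
rewrite (_ : sqnorm = fun s => \sum_(i < 2 * d) nth 0 s i ^+ 2); last first.
  by apply/funext => s; rewrite sqnormE.
apply: measurable_sum => i; apply: measurable_funX; exact: measurable_nth_seq.
Qed.

(** The closed unit ball without the origin, where no direction is defined. Functions of the
    direction integrated over it give sphere integrals up to a constant factor. *)
Definition sphere_dom : set seqR := [set s | 0 < sqnorm s <= 1].

Lemma measurable_sphere_dom : measurable sphere_dom.
Proof.
rewrite (_ : sphere_dom = sqnorm @^-1` `]0, 1]); last first.
  by apply/seteqP; split=> s /=; rewrite in_itv.
by rewrite -[X in measurable X]setTI; apply: measurable_sqnorm.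
Qed.

Definition box m (I : interval R) : set seqR :=
  [set s | forall i, (i < m)%N -> nth 0 s i \in I].

Lemma leb_seq_box m (I : interval R) :
  leb_seq m (box m I) = (\prod_(i < m) lebesgue_measure [set` I])%E.
Proof.
elim: m => [|m IH].
  by rewrite big_ord0 /leb_seq/= indicE mem_set.
rewrite big_ord_recr/= -IH [LHS]/leb_seq/=.
rewrite -[X in (_ * lebesgue_measure X)%E]setIT -integral_indic//.
rewrite -ge0_integralZl//=; last first.
  by apply/measurable_EFinP; exact: measurable_indic.
apply: eq_integral => x _; rewrite indicE; case: (boolP (x \in I)) => xI.
  rewrite mem_set// mule1; apply: eq_iter_leb => s _; congr (_%:E).
  rewrite !indicE; congr (_%:R); congr (nat_of_bool _).
  apply/idP/idP => /set_mem/= H; apply/mem_set => /=.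
    by move=> i im; exact: (H i.+1).
  by move=> [|i] im //=; exact: H.
rewrite memNset ?mule0/=; last exact/negP.
rewrite (@eq_iter_leb _ _ _ (fun s => (\1_(set0 : set seqR) s)%:E)).
  exact: (measure0 (@leb_seq R m)).
move=> s _; rewrite !indicE in_set0 memNset//= => /(_ 0%N)/= /(_ isT).
exact/negP.
Qed.

Lemma le_leb_seq m (A B : set seqR) : A `<=` B -> (leb_seq m A <= leb_seq m B)%E.
Proof.
move=> AB; apply: le_iter_leb => s; rewrite lee_fin // !indicE.
case: (boolP (s \in A)) => // /set_mem/AB sB; by rewrite mem_set.
Qed.

Lemma prode_const_itv m (I : interval R) (r : R) : 0 < r ->
  lebesgue_measure [set` I] = r%:E ->
  (\prod_(i < m) lebesgue_measure [set` I])%E = (r ^+ m)%:E.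
Proof.
by move=> r0 ->; elim: m => [|m IH]; rewrite ?big_ord0// big_ord_recr IH exprSr.
Qed.

Lemma sphere_dom_fin : (vol sphere_dom < +oo)%E.
Proof.
have le1 : (vol sphere_dom <= vol (box (2 * d) `[(-1)%R, 1%R]%O))%E.
  apply: le_leb_seq => s /andP[_ s1] i im; rewrite in_itv/=.
  rewrite -ler_norml -(@expr_le1 _ 2)// real_normK ?num_real//.
  apply: le_trans s1; rewrite sqnormE (bigD1 (Ordinal im))//= lerDl.
  by apply: sumr_ge0 => j _; exact: sqr_ge0.
apply: (le_lt_trans le1); rewrite leb_seq_box (@prode_const_itv _ _ 2) ?ltry//.
by rewrite lebesgue_measure_itv/= lte_fin ifT; [rewrite -EFinB; congr EFin; ring|lra].
Qed.

Lemma sphere_dom_gt0 : (0 < d)%N -> (0 < vol sphere_dom)%E.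
Proof.
(* The cube with sides []0, r]], [r = 1 / (2 d)], lies in the ball: since [r <= 1], its squared
   norms are at most [2 d r = 1], and the open end excludes the origin. *)
move=> d0; pose r : R := (2 * d)%:R^-1.
have D0 : 0 < (2 * d)%:R :> R by rewrite ltr0n muln_gt0.
have r0 : 0 < r by rewrite invr_gt0.
have r1 : r <= 1 by rewrite invf_le1// ler1n muln_gt0.
apply: (@lt_le_trans _ _ (vol (box (2 * d) `]0, r]%O))).
  rewrite leb_seq_box (@prode_const_itv _ _ r)// ?lte_fin ?exprn_gt0//.
  by rewrite lebesgue_measure_itv/= lte_fin r0 oppr0 adde0.
apply: le_leb_seq => s sr; rewrite /sphere_dom/= sqnormE.
have {}sr i : (i < 2 * d)%N -> 0 < nth 0 s i <= r by move/sr; rewrite in_itv.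
apply/andP; split.
  have H : (0 < 2 * d)%N by rewrite muln_gt0.
  rewrite (bigD1 (Ordinal H))//= ltr_pwDl//; last first.
    by apply: sumr_ge0 => j _; exact: sqr_ge0.
  by have /andP[? _] := sr _ H; rewrite exprn_gt0.
apply: (@le_trans _ _ (\sum_(i < 2 * d) r)).
  apply: ler_sum => i _; have /andP[s0 s1] := sr i (ltn_ord i).
  rewrite expr2; apply: (@le_trans _ _ (r * 1)); last by rewrite mulr1.
  by apply: ler_pM; rewrite ?(ltW s0)//; exact: le_trans s1 r1.
by rewrite sumr_const card_ord -[leLHS]mulr_natr mulVf// gt_eqF.
Qed.

End SphereMoments.

(** * Integrals of functions of the direction and their symmetries *)

Section ComplexMean.
Context {R : realType} (d : nat).
Local Notation seqR := (seqM R).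
Local Notation vol := (@leb_seq R (2 * d)).
Local Notation D := (@sphere_dom R d).
Local Notation Re := (@complex.Re R).
Local Notation Im := (@complex.Im R).
Implicit Types (s : seqR) (f g : seqR -> R[i]) (h : seqR -> R).

(** The bound is required on all sequences, so the class is closed under sums and products; the
    finite volume of the ball makes its members integrable there. *)
Definition bmeas h := measurable_fun setT h /\ exists C, forall s, `|h s| <= C.

Definition cbmeas f := bmeas (fun s => Re (f s)) /\ bmeas (fun s => Im (f s)).

Lemma bmeas_cst (c : R) : bmeas (fun=> c).
Proof. by split; [exact: measurable_cst|exists `|c|]. Qed.

Lemma bmeasD h1 h2 : bmeas h1 -> bmeas h2 -> bmeas (fun s => h1 s + h2 s).
Proof.
move=> [m1 [C1 b1]] [m2 [C2 b2]]; split; first exact: measurable_funD.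
by exists (C1 + C2) => s; rewrite (le_trans (ler_normD _ _))// lerD.
Qed.

Lemma bmeasM h1 h2 : bmeas h1 -> bmeas h2 -> bmeas (fun s => h1 s * h2 s).
Proof.
move=> [m1 [C1 b1]] [m2 [C2 b2]]; split; first exact: measurable_funM.
by exists (C1 * C2) => s; rewrite normrM ler_pM.
Qed.

Lemma bmeasN h : bmeas h -> bmeas (fun s => - h s).
Proof.
move=> [m [C b]]; split; first exact: measurable_funN.
by exists C => s; rewrite normrN.
Qed.

Lemma bmeas_integrable h : bmeas h -> vol.-integrable D (EFin \o h).
Proof.
move=> [mh [C bh]]; apply: measurable_bounded_integrable.
- exact: measurable_sphere_dom.
- exact: sphere_dom_fin.
- exact: measurable_funTS.
- exists C; split; first exact: num_real.
  by move=> x Cx s _ /=; exact: le_trans (bh s) (ltW Cx).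
Qed.

Lemma cbmeas_cst (c : R[i]) : cbmeas (fun=> c).
Proof. by split; exact: bmeas_cst. Qed.

Lemma ReD (x y : R[i]) : Re (x + y) = Re x + Re y. Proof. by case: x y => ? ? []. Qed.
Lemma ImD (x y : R[i]) : Im (x + y) = Im x + Im y. Proof. by case: x y => ? ? []. Qed.
Lemma ReM (x y : R[i]) : Re (x * y) = Re x * Re y - Im x * Im y.
Proof. by case: x y => ? ? []. Qed.
Lemma ImM (x y : R[i]) : Im (x * y) = Re x * Im y + Im x * Re y.
Proof. by case: x y => ? ? []. Qed.

Lemma cbmeasD f g : cbmeas f -> cbmeas g -> cbmeas (fun s => f s + g s).
Proof.
move=> [f1 f2] [g1 g2]; split.
  by under eq_fun do rewrite ReD; exact: bmeasD.
by under eq_fun do rewrite ImD; exact: bmeasD.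
Qed.

Lemma cbmeasM f g : cbmeas f -> cbmeas g -> cbmeas (fun s => f s * g s).
Proof.
move=> [f1 f2] [g1 g2]; split.
  under eq_fun do rewrite ReM.
  by apply: bmeasD; [|apply: bmeasN]; exact: bmeasM.
by under eq_fun do rewrite ImM; apply: bmeasD; exact: bmeasM.
Qed.

Lemma cbmeas_conj f : cbmeas f -> cbmeas (fun s => conjc (f s)).
Proof.
move=> [f1 f2]; split.
  rewrite (_ : (fun _ => _) = fun s => Re (f s))//; apply/funext => s; by case: (f s).
rewrite (_ : (fun _ => _) = fun s => - Im (f s)); first exact: bmeasN.
by apply/funext => s; case: (f s).
Qed.

Lemma cbmeas_sum (I : Type) (r : seq I) (F : I -> seqR -> R[i]) :
  (forall i, cbmeas (F i)) -> cbmeas (fun s => \sum_(i <- r) F i s).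
Proof.
move=> HF; elim: r => [|i r IH].
  by under eq_fun do rewrite big_nil; exact: cbmeas_cst.
by under eq_fun do rewrite big_cons; exact: cbmeasD.
Qed.

Definition sphere_int f : R[i] :=
  ((\int[vol]_(s in D) Re (f s)) +i* (\int[vol]_(s in D) Im (f s)))%C.

Lemma eq_sphere_int f g : {in D, f =1 g} -> sphere_int f = sphere_int g.
Proof.
by move=> fg; congr Complex; apply: eq_Rintegral => s /fg ->.
Qed.

Lemma sphere_intD f g : cbmeas f -> cbmeas g -> sphere_int (fun s => f s + g s) = sphere_int f + sphere_int g.
Proof.
move=> [f1 f2] [g1 g2]; rewrite /sphere_int.
under eq_Rintegral do rewrite ReD.
under [X in (_ +i* X)%C]eq_Rintegral do rewrite ImD.
by rewrite !RintegralD//; try exact: measurable_sphere_dom; exact: bmeas_integrable.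
Qed.

Lemma sphere_intZ c f : cbmeas f -> sphere_int (fun s => c * f s) = c * sphere_int f.
Proof.
move=> [f1 f2]; rewrite /sphere_int.
have mD := @measurable_sphere_dom R d.
have I1 := bmeas_integrable f1; have I2 := bmeas_integrable f2.
have J1 a := bmeas_integrable (bmeasM (bmeas_cst a) f1).
have J2 a := bmeas_integrable (bmeasM (bmeas_cst a) f2).
under eq_Rintegral do rewrite ReM.
under [X in (_ +i* X)%C]eq_Rintegral do rewrite ImM.
rewrite RintegralB//; try by [exact: J1|exact: J2].
rewrite RintegralD//; try by [exact: J1|exact: J2].
by rewrite !RintegralZl//; case: c.
Qed.

Lemma sphere_int_sum (I : Type) (r : seq I) (F : I -> seqR -> R[i]) :
  (forall i, cbmeas (F i)) ->
  sphere_int (fun s => \sum_(i <- r) F i s) = \sum_(i <- r) sphere_int (F i).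
Proof.
move=> HF; elim: r => [|i r IH].
  rewrite big_nil /sphere_int; under eq_Rintegral do rewrite big_nil.
  under [X in (_ +i* X)%C]eq_Rintegral do rewrite big_nil.
  by rewrite !Rintegral_cst ?mul0r//; exact: measurable_sphere_dom.
rewrite big_cons -IH -sphere_intD//; last exact: cbmeas_sum.
by apply: eq_sphere_int => s _; rewrite big_cons.
Qed.

Definition sphere_symmetry (sigma : seqR -> seqR) :=
  [/\ measurable_fun setT sigma,
      forall A : set seqR, measurable A -> vol (sigma @^-1` A) = vol A
    & forall s, sqnorm d (sigma s) = sqnorm d s].

Lemma sphere_symmetry_comp sigma tau :
  sphere_symmetry sigma -> sphere_symmetry tau -> sphere_symmetry (sigma \o tau).
Proof.
move=> [ms vs rs] [mt vt rt]; split.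
- exact: measurableT_comp.
- move=> A mA; rewrite -(vs A mA) -(vt (sigma @^-1` A))//.
  by rewrite -[X in measurable X]setTI; exact: ms.
- by move=> s /=; rewrite rs rt.
Qed.

Lemma sqnorm_rot a b t s : (a < 2 * d)%N -> (b < 2 * d)%N -> a != b ->
  sqnorm d (rot a b t s) = sqnorm d s.
Proof.
move=> ad bd ab; rewrite !sqnormE.
pose A := Ordinal ad; pose B := Ordinal bd.
have BA : B != A by rewrite eq_sym.
rewrite (bigD1 A)// (bigD1 B)//= [RHS](bigD1 A)// [in RHS](bigD1 B)//= !addrA.
congr (_ + _); last first.
  apply: eq_bigr => i /andP[iA iB]; rewrite nth_rot//.
  by rewrite -[i == a :> nat]/(i == A) -[i == b :> nat]/(i == B) (negbTE iA) (negbTE iB).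
rewrite !nth_rot// !eqxx eq_sym (negbTE ab).
have t0 : 1 + t ^+ 2 != 0 by rewrite gt_eqF// ltr_wpDr// ?sqr_ge0.
by field.
Qed.

Lemma sphere_symmetry_rot a b t : (a < 2 * d)%N -> (b < 2 * d)%N -> a != b ->
  sphere_symmetry (rot a b t).
Proof.
move=> ad bd ab; split.
- exact: measurable_rot.
- by move=> A; exact: leb_seq_rot.
- by move=> s; exact: sqnorm_rot.
Qed.

Lemma Rintegral_symmetry sigma h : sphere_symmetry sigma -> bmeas h ->
  \int[vol]_(s in D) h (sigma s) = \int[vol]_(s in D) h s.
Proof.
move=> [ms vs rs] bh; rewrite /Rintegral; congr fine.
have DE : sigma @^-1` D = D by apply/seteqP; split=> s /=; rewrite /sphere_dom/= rs.
have mD := @measurable_sphere_dom R d.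
rewrite -[in LHS]DE.
rewrite -(@integral_pushforward _ _ seqR seqR R sigma ms vol D (EFin \o h))//.
- by apply: eq_measure_integral => A mA _; exact: (vs A mA).
- by apply/measurable_EFinP; case: bh.
- rewrite DE; apply: (@bmeas_integrable (h \o sigma)).
  case: bh => mh [C bC]; split; last by exists C => s; exact: bC.
  exact: measurableT_comp.
Qed.

Lemma sphere_int_symmetry sigma f : sphere_symmetry sigma -> cbmeas f ->
  sphere_int (f \o sigma) = sphere_int f.
Proof.
move=> ss [f1 f2]; rewrite /sphere_int; congr Complex; exact: Rintegral_symmetry.
Qed.

(** Coordinate of the normalized vector, locked against unfolding. Where the norm is 0 the inverse
    is 0 too, so the function is bounded everywhere. *)
Definition ucoord j s : R[i] := locked (((Num.sqrt (sqnorm d s))^-1)%:C%C * zcoord j s).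

Lemma ucoordE j s : ucoord j s = ((Num.sqrt (sqnorm d s))^-1)%:C%C * zcoord j s.
Proof. by rewrite /ucoord -lock. Qed.

Lemma measurable_inv_sqrt_sqnorm : measurable_fun setT (fun s => (Num.sqrt (sqnorm d s))^-1).
Proof.
rewrite (_ : (fun _ => _) = (fun x => powR x (- 2^-1)) \o (@sqnorm R d)).
  by apply: measurableT_comp; [exact: measurable_powR|exact: measurable_sqnorm].
by apply/funext => s /=; rewrite powRN powR12_sqrt// sqnorm_ge0.
Qed.

Lemma coord_le_sqnorm i s : (i < 2 * d)%N -> nth 0 s i ^+ 2 <= sqnorm d s.
Proof.
move=> im; rewrite sqnormE (bigD1 (Ordinal im))//= lerDl.
by apply: sumr_ge0 => j _; exact: sqr_ge0.
Qed.

Lemma bmeas_unit_coord i : (i < 2 * d)%N ->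
  bmeas (fun s => (Num.sqrt (sqnorm d s))^-1 * nth 0 s i).
Proof.
move=> im; split.
  by apply: measurable_funM; [exact: measurable_inv_sqrt_sqnorm|exact: measurable_nth_seq].
exists 1 => s; rewrite -(@expr_le1 _ 2)// real_normK ?num_real//.
rewrite exprMn exprVn sqr_sqrtr ?sqnorm_ge0//.
have [->|r0] := eqVneq (sqnorm d s) 0; first by rewrite invr0 mul0r.
by rewrite mulrC ler_pdivrMr ?mul1r ?coord_le_sqnorm// lt_neqAle eq_sym r0 sqnorm_ge0.
Qed.

Lemma cbmeas_ucoord j : (j < d)%N -> cbmeas (ucoord j).
Proof.
move=> jd; split.
  rewrite (_ : (fun _ => _) = fun s => (Num.sqrt (sqnorm d s))^-1 * nth 0 s (2 * j)).
    by apply: bmeas_unit_coord; rewrite ltn_pmul2l.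
  by apply/funext => s; rewrite ucoordE ReM /= mul0r subr0.
rewrite (_ : (fun _ => _) = fun s => (Num.sqrt (sqnorm d s))^-1 * nth 0 s (2 * j).+1).
  by apply: bmeas_unit_coord; rewrite mul2n -doubleS -mul2n leq_mul2l.
by apply/funext => s; rewrite ucoordE ImM /= mul0r addr0.
Qed.

Lemma sum_ucoord s : D s -> \sum_(j < d) conjc (ucoord j s) * ucoord j s = 1.
Proof.
move=> /andP[r0 _].
transitivity (((sqnorm d s)^-1 * sqnorm d s)%:C%C); last by rewrite mulVf// gt_eqF.
rewrite {2}/sqnorm /normsq mulr_sumr rmorph_sum; apply: eq_bigr => j _ /=.
rewrite mxE /= ucoordE /zcoord; have := sqr_sqrtr (ltW r0).
move: (Num.sqrt _) => r; move: (sqnorm d s) => r' <-.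
rewrite -exprVn; apply/eqP; rewrite eq_complex /=; apply/andP; split; apply/eqP; ring.
Qed.

End ComplexMean.

(** * Fourth moments on the sphere *)

Section ConjcMorphism.
Context {R : rcfType}.
Implicit Types x y : R[i].

Lemma conjcM x y : conjc (x * y) = conjc x * conjc y. Proof. exact: rmorphM. Qed.
Lemma conjcD x y : conjc (x + y) = conjc x + conjc y. Proof. exact: rmorphD. Qed.
Lemma conjcN x : conjc (- x) = - conjc x. Proof. exact: rmorphN. Qed.
Lemma conjc_sum (I : Type) (r : seq I) (P : pred I) (F : I -> R[i]) :
  conjc (\sum_(i <- r | P i) F i) = \sum_(i <- r | P i) conjc (F i).
Proof. exact: rmorph_sum. Qed.

End ConjcMorphism.

Section QuarticMoments.
Context {R : realType} (d : nat).
Local Notation seqR := (seqM R).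
Local Notation D := (@sphere_dom R d).
Local Notation C := R[i].
Implicit Types (s : seqR) (i j k l p : 'I_d).

Let eq22 a b : (2 * a == 2 * b)%N = (a == b). Proof. by rewrite eqn_pmul2l. Qed.
Let eq23 a b : (2 * a == (2 * b).+1)%N = false.
Proof. by apply/negP => /eqP/(congr1 odd); rewrite /= !mul2n !odd_double. Qed.
Let eq32 a b : ((2 * a).+1 == 2 * b)%N = false. Proof. by rewrite eq_sym eq23. Qed.
Let eq33 a b : ((2 * a).+1 == (2 * b).+1)%N = (a == b). Proof. by rewrite eqSS eq22. Qed.
Let lt2 i : (2 * i < 2 * d)%N. Proof. by rewrite ltn_pmul2l. Qed.
Let lt3 i : ((2 * i).+1 < 2 * d)%N.
Proof. by rewrite mul2n -doubleS -mul2n leq_mul2l /=; exact: ltn_ord. Qed.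

(** Half-angle tangent 1 is a quarter turn of real and imaginary part, hence multiplication of one
    coordinate by [i]. *)
Definition phase p : seqR -> seqR := rot (2 * p) (2 * p).+1 1.

(** Rotating real and imaginary parts alike acts on the pair [(z_k, z_l)] by a real orthogonal
    matrix. *)
Definition crot k l (t : R) : seqR -> seqR :=
  rot (2 * k) (2 * l) t \o rot (2 * k).+1 (2 * l).+1 t.

Lemma sphere_symmetry_phase p : sphere_symmetry d (phase p).
Proof. by apply: sphere_symmetry_rot => //; rewrite eq23. Qed.

Lemma sphere_symmetry_crot k l t : k != l -> sphere_symmetry d (crot k l t).
Proof.
move=> kl; apply: sphere_symmetry_comp; apply: sphere_symmetry_rot => //.
  by rewrite eq22.
by rewrite eq33.
Qed.

Definition phase_factor p q : C := if q == p then 'i%C else 1.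

Lemma phase_factor_id p : phase_factor p p = 'i%C.
Proof. by rewrite /phase_factor eqxx. Qed.

Lemma phase_factor_neq p q : q != p -> phase_factor p q = 1.
Proof. by rewrite /phase_factor => /negbTE ->. Qed.

Lemma phase_factor_neqC p q : p != q -> phase_factor p q = 1.
Proof. by rewrite eq_sym; exact: phase_factor_neq. Qed.

Lemma ucoord_phase p j s : ucoord d j (phase p s) = phase_factor p j * ucoord d j s.
Proof.
have [_ _ rE] := sphere_symmetry_phase p.
rewrite !ucoordE rE mulrCA; congr (_ * _).
rewrite /zcoord /phase !nth_rot ?eq23// ?(eq22, eq33, eq32, eq23).
rewrite -[(j == p :> nat)]/(j == p) /phase_factor; case: eqVneq => [->|_]; last by rewrite mul1r.
have e : 2 * 1 / (1 + 1 ^+ 2) = 1 :> R by rewrite expr1n mulr1 divff// pnatr_eq0.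
rewrite e expr1n subrr mul0r.
by apply/eqP; rewrite eq_complex /=; apply/andP; split; apply/eqP; ring.
Qed.

Lemma ucoord_crot_l k l t s : k != l -> ucoord d k (crot k l t s) =
  ((1 - t ^+ 2) / (1 + t ^+ 2))%:C%C * ucoord d k s - (2 * t / (1 + t ^+ 2))%:C%C * ucoord d l s.
Proof.
move=> kl; have [_ _ rE] := sphere_symmetry_crot t kl.
rewrite !ucoordE rE /zcoord /crot /= !nth_rot ?eq22 ?eq33// !eqxx !eq23 !eq32 ?eqxx.
apply/eqP; rewrite eq_complex /=; apply/andP; split; apply/eqP; ring.
Qed.

Definition mon i j k l s : C := conjc (ucoord d i s) * ucoord d j s * (ucoord d k s * conjc (ucoord d l s)).

Definition mom i j k l : C := sphere_int d (mon i j k l).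

Lemma cbmeas_mon i j k l : cbmeas (mon i j k l).
Proof.
have cu (j' : 'I_d) := @cbmeas_ucoord R d j' (ltn_ord j'); have cc j' := cbmeas_conj (cu j').
by apply: cbmeasM; apply: cbmeasM.
Qed.

Lemma mom_phase p i j k l :
  mom i j k l = conjc (phase_factor p i) * phase_factor p j *
    (phase_factor p k * conjc (phase_factor p l)) * mom i j k l.
Proof.
rewrite -sphere_intZ; last exact: cbmeas_mon.
rewrite {1}/mom -(sphere_int_symmetry (sphere_symmetry_phase p)); last exact: cbmeas_mon.
by apply: eq_sphere_int => s _ /=; rewrite /mon !ucoord_phase !conjcM; ring.
Qed.

(* The phase change u_p -> i u_p preserves the measure and multiplies the moment
   by a power of i, which differs from 1 for a suitable p. *)
Lemma mom_eq0 i j k l : ~~ ((i == j) && (k == l)) -> ~~ ((i == k) && (j == l)) ->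
  mom i j k l = 0.
Proof.
move=> H1 H2.
have key (c : C) : c != 1 -> mom i j k l = c * mom i j k l -> mom i j k l = 0.
  move=> c1 /eqP; rewrite -subr_eq0 -[X in X - _]mul1r -mulrBl mulf_eq0 subr_eq0.
  by rewrite eq_sym (negbTE c1) => /eqP.
have ni1 : ('i : C)%C != 1 by rewrite eq_complex /= negb_and eq_sym oner_neq0.
have nNi1 : conjc ('i : C)%C != 1.
  by rewrite eq_complex /= negb_and eq_sym oner_neq0.
have ii : conjc ('i : C)%C * 'i%C = 1.
  by apply/eqP; rewrite eq_complex /=; apply/andP; split; apply/eqP; ring.
(* Two conjugate factors meet when [l = i] while [j] and [k] differ from [i]; their product is
   -1. *)
have NN : conjc ('i : C)%C * conjc ('i : C)%C != 1.
  rewrite eq_complex /= negb_and mulrNN !mul0r sub0r mulr1.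
  by rewrite -subr_eq0 -opprD oppr_eq0 (gt_eqF (addr_gt0 _ _)).
have [ij|ij] := eqVneq i j; last first.
  have [ik|ik] := eqVneq i k.
    have jl : j != l by move: H2; rewrite ik eqxx.
    apply: (key _ _ (mom_phase j i j k l)).
    rewrite -ik (phase_factor_neq ij) phase_factor_id (phase_factor_neqC jl).
    by rewrite conjc1 ?mul1r ?mulr1.
  apply: (key _ _ (mom_phase i i j k l)).
  rewrite phase_factor_id (phase_factor_neqC ij).
  rewrite (phase_factor_neqC ik) mulr1 mul1r.
  have [->|li] := eqVneq l i; first by rewrite phase_factor_id.
  by rewrite phase_factor_neq// conjc1 mulr1.
have kl : k != l by move: H1; rewrite ij eqxx.
apply: (key _ _ (mom_phase k i j k l)).
rewrite ij phase_factor_id (phase_factor_neqC kl) conjc1 mulr1.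
have [->|li] := eqVneq j k; first by rewrite phase_factor_id ii mul1r.
by rewrite phase_factor_neq// conjc1 !mul1r.
Qed.

Definition qmom i j : C := mom i i j j.

Lemma mom_exchange i j : mom i j i j = qmom i j.
Proof. by apply: eq_sphere_int => s _; rewrite /mon; ring. Qed.

Lemma qmomC i j : qmom i j = qmom j i.
Proof. by apply: eq_sphere_int => s _; rewrite /mon; ring. Qed.

(** Only the two pairings survive; they overlap when all indices agree, and the last term removes
    the double count. *)
Lemma momE i j k l : mom i j k l =
  ((i == j) && (k == l))%:R * qmom i k + ((i == k) && (j == l))%:R * qmom i j
  - ([&& i == j, i == k & j == l])%:R * qmom i i.
Proof.
have [/andP[/eqP <- /eqP <-]|H1] := boolP ((i == j) && (k == l)).
  rewrite ?eqxx !andbb /=; case: eqVneq => [<-|_]; rewrite ?mul1r ?mul0r ?subr0 ?addr0 ?addrK//.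
have [/andP[/eqP ik /eqP jl]|H2] := boolP ((i == k) && (j == l)).
  rewrite -ik -jl ?eqxx ?andbT mom_exchange; case: eqVneq => [ij|_].
    by move: H1; rewrite -ik -jl ij !eqxx.
  by rewrite mul1r !mul0r subr0 add0r.
by rewrite mom_eq0// !mul0r add0r andbF ?mul0r subr0.
Qed.

Definition qform (A : 'M[C]_d) s : C :=
  \sum_(p : 'I_d * 'I_d) A p.1 p.2 * (conjc (ucoord d p.1 s) * ucoord d p.2 s).

Lemma cbmeas_qform A : cbmeas (qform A).
Proof.
apply: cbmeas_sum => p; apply: cbmeasM; first exact: cbmeas_cst.
by apply: cbmeasM; [apply: cbmeas_conj|]; exact: cbmeas_ucoord.
Qed.

Lemma sphere_int_qform_sq A : sphere_int d (fun s => qform A s * conjc (qform A s)) =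
  \sum_i \sum_k A i i * conjc (A k k) * qmom i k
  + \sum_i \sum_j A i j * conjc (A i j) * qmom i j
  - \sum_i A i i * conjc (A i i) * qmom i i.
Proof.
transitivity (\sum_(p : 'I_d * 'I_d) \sum_(q : 'I_d * 'I_d)
    A p.1 p.2 * conjc (A q.1 q.2) * mom p.1 p.2 q.1 q.2).
  transitivity (sphere_int d (fun s => \sum_(p : 'I_d * 'I_d) \sum_(q : 'I_d * 'I_d)
      A p.1 p.2 * conjc (A q.1 q.2) * mon p.1 p.2 q.1 q.2 s)).
    apply: eq_sphere_int => s _; rewrite /qform conjc_sum big_distrlr /=.
    apply: eq_bigr => p _; apply: eq_bigr => q _.
    rewrite /mon; move: (ucoord d p.1 s) (ucoord d p.2 s) (ucoord d q.1 s) (ucoord d q.2 s) => a b c e.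
    by rewrite !conjcM conjcK; ring.
  rewrite sphere_int_sum => [|p]; last first.
    by apply: cbmeas_sum => q; apply: cbmeasM; [exact: cbmeas_cst|exact: cbmeas_mon].
  apply: eq_bigr => p _; rewrite sphere_int_sum => [|q]; last first.
    by apply: cbmeasM; [exact: cbmeas_cst|exact: cbmeas_mon].
  by apply: eq_bigr => q _; rewrite sphere_intZ//; exact: cbmeas_mon.
under eq_bigr do under eq_bigr do rewrite momE mulrBr mulrDr.
under eq_bigr do rewrite sumrB big_split /=.
rewrite sumrB big_split /=; congr (_ + _ - _).
- rewrite -(pair_bigA _ (fun i j => \sum_(q : 'I_d * 'I_d) A i j * conjc (A q.1 q.2) *
     (((i == j) && (q.1 == q.2))%:R * qmom i q.1))) /=.
  apply: eq_bigr => i _; rewrite (bigD1 i)//= [X in _ + X]big1 ?addr0; last first.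
    move=> j ji; rewrite big1// => q _.
    by rewrite (eq_sym i) (negbTE ji) /= mul0r mulr0.
  rewrite -(pair_bigA _ (fun k l => A i i * conjc (A k l) *
     (((i == i) && (k == l))%:R * qmom i k))) /=.
  apply: eq_bigr => k _; rewrite (bigD1 k)//= [X in _ + X]big1 ?addr0; last first.
    by move=> l lk; rewrite (eq_sym k) (negbTE lk) andbF mul0r mulr0.
  by rewrite !eqxx mul1r.
- rewrite (pair_bigA _ (fun i j => A i j * conjc (A i j) * qmom i j)) /=.
  apply: eq_bigr => p _; rewrite (bigD1 p)//= [X in _ + X]big1 ?addr0; last first.
    move=> q qp; rewrite -xpair_eqE -!surjective_pairing eq_sym (negbTE qp).
    by rewrite mul0r mulr0.
  by rewrite !eqxx mul1r.
rewrite -(pair_bigA _ (fun i j => \sum_(q : 'I_d * 'I_d) A i j * conjc (A q.1 q.2) *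
     (([&& i == j, i == q.1 & j == q.2])%:R * qmom i i))) /=.
apply: eq_bigr => i _; rewrite (bigD1 i)//= [X in _ + X]big1 ?addr0; last first.
  move=> j ji; rewrite big1// => q _.
  by rewrite (eq_sym i) (negbTE ji) /= mul0r mulr0.
rewrite (bigD1 (i, i))//= [X in _ + X]big1 ?addr0; last first.
  move=> [k l] /=; rewrite xpair_eqE (eq_sym k) (eq_sym l) => /negbTE ->.
  by rewrite andbF mul0r mulr0.
by rewrite !eqxx mul1r.
Qed.

(** The square of [sum_j |u_j|^2 = 1], integrated, fixes the scale that the symmetries leave
    open. *)
Lemma qmom_sum : \sum_i \sum_j qmom i j = (fine (@leb_seq R (2 * d) D))%:C%C.
Proof.
transitivity (sphere_int d (fun s => \sum_i \sum_j mon i i j j s)).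
  rewrite sphere_int_sum => [|i]; last by apply: cbmeas_sum => j; exact: cbmeas_mon.
  by apply: eq_bigr => i _; rewrite sphere_int_sum// => j; exact: cbmeas_mon.
rewrite (@eq_sphere_int _ _ _ (fun=> 1)); last first.
  move=> s /set_mem Ds; rewrite /mon -big_distrlr /= sum_ucoord// mul1r.
  by rewrite (eq_bigr (fun j : 'I_d => conjc (ucoord d j s) * ucoord d j s)) ?sum_ucoord// => j _; rewrite mulrC.
rewrite /sphere_int; congr Complex; rewrite Rintegral_cst ?mul1r ?mul0r//;
  exact: measurable_sphere_dom.
Qed.

Let qmom_rot (k l i j : 'I_d) t : k != l ->
  sphere_int d (mon i i j j \o crot k l t) = qmom i j.
Proof.
by move=> kl; apply: sphere_int_symmetry; [exact: sphere_symmetry_crot|exact: cbmeas_mon].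
Qed.

Lemma ucoord_crot1_l k l s : k != l -> ucoord d k (crot k l 1 s) = - ucoord d l s.
Proof.
move=> kl; rewrite ucoord_crot_l// expr1n subrr mul0r mulr1 divff ?pnatr_eq0//.
by rewrite mul0r mul1r sub0r.
Qed.

(** The quarter turn sends [u_k] to [- u_l], and the sign disappears in a fourth power. *)
Lemma qmom_diag k l : qmom k k = qmom l l.
Proof.
have [->//|kl] := eqVneq k l; rewrite -(qmom_rot k k 1 kl).
apply: eq_sphere_int => s _; rewrite /= /mon !ucoord_crot1_l//.
by move: (ucoord d l s) => x; rewrite conjcN; ring.
Qed.

Let sum_pair (k l : 'I_d) (F : 'I_d -> C) : k != l ->
  (forall i, i != k -> i != l -> F i = 0) -> \sum_i F i = F k + F l.
Proof.
move=> kl F0; rewrite (bigD1 k)//= (bigD1 l) 1?eq_sym//= big1 ?addr0// => i.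
by case/andP; exact: F0.
Qed.

(* Invariance under the rotation with cosine 3/5 and sine 4/5 forces the ratio
   of the two kinds of quartic moments. *)
Lemma qmom_diag_offdiag k l : k != l -> qmom k k = 2 * qmom k l.
Proof.
move=> kl.
have [a [b [ca cb ab1 ab0 Eu]]] : exists a b : C, [/\ conjc a = a, conjc b = b,
    a ^+ 2 + b ^+ 2 = 1, a ^+ 2 * b ^+ 2 != 0 &
    forall s, ucoord d k (crot k l 2^-1 s) = a * ucoord d k s + b * ucoord d l s].
  pose t : R := 2^-1; have t0 : 1 + t ^+ 2 != 0 by rewrite gt_eqF// ltr_wpDr// ?sqr_ge0.
  have E1 : (1 - t ^+ 2) / (1 + t ^+ 2) = 3 / 5.
    by rewrite /t; field.
  have E2 : 2 * t / (1 + t ^+ 2) = 4 / 5.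
    by rewrite /t; field.
  exists (3 / 5)%:C%C, (- (4 / 5))%:C%C; rewrite !conjc_real -!rmorphXn /= -rmorphM -rmorphD /=.
  split=> //.
  - by rewrite -(rmorph1 (real_complex R)); congr (_%:C)%C; field.
  - rewrite -(rmorph0 (real_complex R)) (inj_eq (@complexI R)).
    by rewrite mulf_neq0// expf_neq0 ?oppr_eq0// mulf_neq0 ?invr_eq0 ?pnatr_eq0.
  - by move=> s; rewrite ucoord_crot_l// E1 E2 rmorphN mulNr.
(* [c] is the row of the rotation that produces the new [u_k]. Then [|sum_i c_i u_i|^2] is the
   quadratic form of [c_i c_j], whose square has a known expansion. *)
pose c i : C := if i == k then a else if i == l then b else 0.
have ck : c k = a by rewrite /c eqxx.
have cl : c l = b by rewrite /c eqxx eq_sym (negbTE kl).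
have c0 i : i != k -> i != l -> c i = 0 by rewrite /c => /negbTE -> /negbTE ->.
have cr i : conjc (c i) = c i by rewrite /c; do ?case: ifP => _ //; rewrite conjc0.
pose A : 'M[C]_d := \matrix_(i, j) (c i * c j).
have cA i j : A i j = c i * c j by rewrite mxE.
have qE s : qform A s = conjc (ucoord d k (crot k l 2^-1 s)) * ucoord d k (crot k l 2^-1 s).
  rewrite Eu (_ : a * ucoord d k s + b * ucoord d l s = \sum_i c i * ucoord d i s); last first.
    by rewrite (sum_pair kl) ?ck ?cl// => i ik il; rewrite c0// mul0r.
  rewrite conjc_sum big_distrlr pair_bigA /=; apply: eq_bigr => p _.
  by rewrite cA conjcM cr; ring.
have E0 : qmom k k = sphere_int d (fun s => qform A s * conjc (qform A s)).
  rewrite -(qmom_rot k k 2^-1 kl); apply: eq_sphere_int => s _.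
  by rewrite qE /= /mon conjcM conjcK; ring.
have c2 i : i != k -> i != l -> A i i = 0 by move=> ik il; rewrite cA c0// mul0r.
have S1 : \sum_i \sum_j A i i * conjc (A j j) * qmom i j =
  a ^+ 4 * qmom k k + a ^+ 2 * b ^+ 2 * qmom k l + (a ^+ 2 * b ^+ 2 * qmom k l + b ^+ 4 * qmom k k).
  rewrite (sum_pair kl) => [|i ik il]; last by rewrite big1// => j _; rewrite c2// !mul0r.
  rewrite !(sum_pair kl) => [|i ik il|i ik il]; try by rewrite (c2 i)// conjc0 mulr0 mul0r.
  by rewrite !cA !conjcM !cr ck cl -(qmom_diag k l) (qmomC l k); ring.
have S2 : \sum_i \sum_j A i j * conjc (A i j) * qmom i j =
  a ^+ 4 * qmom k k + a ^+ 2 * b ^+ 2 * qmom k l + (a ^+ 2 * b ^+ 2 * qmom k l + b ^+ 4 * qmom k k).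
  rewrite (sum_pair kl) => [|i ik il]; last by rewrite big1// => j _; rewrite cA c0// !mul0r.
  rewrite !(sum_pair kl) => [|i ik il|i ik il]; try by rewrite cA (c0 i)// mulr0 !mul0r.
  by rewrite !cA !conjcM !cr ck cl -(qmom_diag k l) (qmomC l k); ring.
have S3 : \sum_i A i i * conjc (A i i) * qmom i i = a ^+ 4 * qmom k k + b ^+ 4 * qmom k k.
  rewrite (sum_pair kl) => [|i ik il]; last by rewrite c2// !mul0r.
  by rewrite !cA !conjcM !cr ck cl -(qmom_diag k l); ring.
(* The identity reads [x = (a^4 + b^4) x + 4 a^2 b^2 y]; with [a^2 + b^2 = 1] it becomes
   [2 a^2 b^2 x = 4 a^2 b^2 y]. *)
move: E0; rewrite sphere_int_qform_sq S1 S2 S3 => E0.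
apply: (mulfI ab0); move: (qmom k k) (qmom k l) E0 => x y E0.
apply: (mulfI (_ : 2%:R != 0 :> C)); first by rewrite pnatr_eq0.
have b2 : b ^+ 2 = 1 - a ^+ 2 by rewrite -ab1 addrC addKr.
have b4 : b ^+ 4 = (1 - a ^+ 2) ^+ 2 by rewrite -b2 -exprM.
move: E0; rewrite b4 b2 => E0; apply/eqP; rewrite -subr_eq0; apply/eqP.
move/eqP: E0; rewrite -subr_eq0 => /eqP E0.
rewrite -[RHS]E0; ring.
Qed.

(** All moments are [(1 + [i = j]) b] for one [b]; their sum [d (d + 1) b] is the volume of the
    ball. *)
Lemma qmomE i j : qmom i j = (1 + (i == j)%:R) *
  (fine (@leb_seq R (2 * d) D) / (d * d.+1)%:R)%:C%C.
Proof.
pose b := qmom i i / 2.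
have qb k l : qmom k l = (1 + (k == l)%:R) * b.
  rewrite /b; have two0 : (2 : C) != 0 by rewrite pnatr_eq0.
  have [<-|kl] := eqVneq k l; first by rewrite (qmom_diag k i) [true%:R]/(1 : C); field.
  by rewrite (qmom_diag i k) (qmom_diag_offdiag kl) [false%:R]/(0 : C); field.
have d0 : (d * d.+1)%:R != 0 :> C.
  by rewrite pnatr_eq0 -lt0n muln_gt0 andbT; exact: leq_ltn_trans (ltn_ord i).
have := qmom_sum; under eq_bigr do under eq_bigr do rewrite qb.
under eq_bigr => k _.
  rewrite -mulr_suml big_split /= sumr_const card_ord.
  rewrite (bigD1 k)//= eqxx big1 ?addr0; last by move=> l lk; rewrite eq_sym (negbTE lk).
  over.
rewrite sumr_const card_ord -mulr_natl => E.
rewrite qb; congr (_ * _).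
have -> (v : R) : (v / (d * d.+1)%:R)%:C%C = v%:C%C / (d * d.+1)%:R.
  by rewrite rmorphM fmorphV rmorph_nat.
rewrite -E.
apply: (mulIf d0); rewrite divfK// -[RHS]mulr_natl natrM -natr1 [true%:R]/(1 : C).
by ring.
Qed.

Lemma sphere_int_qform A : sphere_int d (fun s => qform A s * conjc (qform A s)) =
  (fine (@leb_seq R (2 * d) D) / (d * d.+1)%:R)%:C%C *
  (\tr A * conjc (\tr A) + \sum_i \sum_j A i j * conjc (A i j)).
Proof.
have e1 (i : 'I_d) : (i == i)%:R = 1 :> C by rewrite eqxx.
rewrite sphere_int_qform_sq; under eq_bigr do under eq_bigr do rewrite qmomE.
under [X in _ + X - _]eq_bigr do under eq_bigr do rewrite qmomE.
under [X in _ - X]eq_bigr do rewrite qmomE e1.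
set beta := (_%:C)%C.
(* Each pairing produces an excess [beta sum_i |A_ii|^2]; the subtracted diagonal has the factor 2
   and cancels both. *)
have S (F : 'I_d -> 'I_d -> C) : \sum_i \sum_j F i j * ((1 + (i == j)%:R) * beta) =
    beta * (\sum_i \sum_j F i j) + beta * (\sum_i F i i).
  rewrite !mulr_sumr -big_split /=; apply: eq_bigr => i _.
  rewrite mulr_sumr (bigD1 i)//= e1 [in RHS](bigD1 i)//=.
  rewrite (_ : \sum_(j < d | j != i) F i j * _ = \sum_(j < d | j != i) beta * F i j).
    by ring.
  apply: eq_bigr => j ji; have e0 : (i == j)%:R = 0 :> C by rewrite eq_sym (negbTE ji).
  by rewrite e0; ring.
rewrite (S (fun i k => A i i * conjc (A k k))) (S (fun i j => A i j * conjc (A i j))).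
rewrite -mulr_suml /mxtrace conjc_sum big_distrlr /=; ring.
Qed.

End QuarticMoments.

(** * Hilbert-Schmidt estimates *)

Section HilbertSchmidt.
Context {R : rcfType}.
Local Notation C := R[i].

Lemma adjmxM m n p (A : 'M[C]_(m, n)) (B : 'M[C]_(n, p)) :
  adjmx (A *m B) = adjmx B *m adjmx A.
Proof. by rewrite /adjmx map_mxM trmx_mul. Qed.

Lemma adjmxK m n (A : 'M[C]_(m, n)) : adjmx (adjmx A) = A.
Proof. by apply/matrixP => i j; rewrite !mxE conjcK. Qed.

Lemma adjmxD m n (A B : 'M[C]_(m, n)) : adjmx (A + B) = adjmx A + adjmx B.
Proof. by apply/matrixP => i j; rewrite !mxE conjcD. Qed.

Lemma adjmxZ m n (c : C) (A : 'M[C]_(m, n)) : adjmx (c *: A) = conjc c *: adjmx A.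
Proof. by apply/matrixP => i j; rewrite !mxE conjcM. Qed.

Lemma adjmx1 n : adjmx (1%:M : 'M[C]_n) = 1%:M.
Proof. by apply/matrixP => i j; rewrite !mxE eq_sym; case: eqP => _; rewrite ?conjc0 ?conjc1. Qed.

Lemma adjmx_sum m n (I : Type) (r : seq I) (P : pred I) (F : I -> 'M[C]_(m, n)) :
  adjmx (\sum_(i <- r | P i) F i) = \sum_(i <- r | P i) adjmx (F i).
Proof.
apply: (big_morph _ (@adjmxD m n)).
by apply/matrixP => i j; rewrite !mxE conjc0.
Qed.

Lemma mxtrace_adj n (A : 'M[C]_n) : \tr (adjmx A) = conjc (\tr A).
Proof. by rewrite /mxtrace conjc_sum; apply: eq_bigr => i _; rewrite !mxE. Qed.

(** The squared Hilbert-Schmidt norm, kept in [R[i]], whose order compares only numbers with equal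
    imaginary parts. *)
Definition hs m n (A : 'M[C]_(m, n)) : C := \tr (A *m adjmx A).

Lemma hsE m n (A : 'M[C]_(m, n)) : hs A = \sum_i \sum_j A i j * conjc (A i j).
Proof.
by apply: eq_bigr => i _; rewrite mxE; apply: eq_bigr => j _; rewrite !mxE.
Qed.

Lemma hs_ge0 m n (A : 'M[C]_(m, n)) : 0 <= hs A.
Proof.
by rewrite hsE; apply: sumr_ge0 => i _; apply: sumr_ge0 => j _; exact: mulcJ_ge0.
Qed.

Lemma hs_adj m n (A : 'M[C]_(m, n)) : hs (adjmx A) = hs A.
Proof. by rewrite /hs adjmxK mxtrace_mulC. Qed.

Lemma hs_projl m n (Q : 'M[C]_m) (A : 'M[C]_(m, n)) : orth_proj Q ->
  hs (Q *m A) = \tr (A *m adjmx A *m Q).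
Proof.
move=> [QQ aQ]; rewrite /hs adjmxM aQ -!mulmxA mxtrace_mulC -!mulmxA QQ.
by rewrite mulmxA.
Qed.

Lemma orth_projC m (Q : 'M[C]_m) : orth_proj Q -> orth_proj (1%:M - Q).
Proof.
move=> [QQ aQ]; split; last by rewrite adjmxD adjmx1 -scaleN1r adjmxZ conjcN conjc1 aQ.
by rewrite mulmxBl mul1mx mulmxBr mulmx1 QQ subrr subr0.
Qed.

(** Pythagoras: the difference is [hs ((1 - Q) A)]. *)
Lemma le_hs_projl m n (Q : 'M[C]_m) (A : 'M[C]_(m, n)) : orth_proj Q ->
  hs (Q *m A) <= hs A.
Proof.
move=> Qp; rewrite -subr_ge0 hs_projl//.
have -> : hs A - \tr (A *m adjmx A *m Q) = hs ((1%:M - Q) *m A).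
  by rewrite hs_projl; [rewrite mulmxBr mulmx1 raddfB|exact: orth_projC].
exact: hs_ge0.
Qed.

Lemma le_hs_projr m n (Q : 'M[C]_n) (A : 'M[C]_(m, n)) : orth_proj Q ->
  hs (A *m Q) <= hs A.
Proof.
move=> Qp; have [_ aQ] := Qp.
by rewrite -hs_adj -(hs_adj A) adjmxM aQ; exact: le_hs_projl.
Qed.

Lemma hs_orth_proj n (Q : 'M[C]_n) : orth_proj Q -> hs Q = \tr Q.
Proof. by move=> [QQ aQ]; rewrite /hs aQ QQ. Qed.

(** In a full-rank factorization [Q = C B], idempotence forces [B C] to be the identity of size
    [rank Q], and [C B], [B C] have the same trace. *)
Lemma mxtrace_idem n (Q : 'M[C]_n) : Q *m Q = Q -> \tr Q = (\rank Q)%:R.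
Proof.
move=> QQ; rewrite -{1}(mulmx_base Q) mxtrace_mulC.
suff -> : row_base Q *m col_base Q = 1%:M by rewrite mxtrace1.
have := QQ; rewrite -{1 2 3}(mulmx_base Q) -mulmxA.
move/(row_full_inj (col_base_full Q)); rewrite mulmxA -[RHS]mul1mx.
by move/(row_free_inj (row_base_free Q)).
Qed.

Lemma hs_resolutionl m n (E : seq R) (Pi : R -> 'M[C]_m) (A : 'M[C]_(m, n)) :
  (forall e, e \in E -> orth_proj (Pi e)) -> \sum_(e <- E) Pi e = 1%:M ->
  \sum_(e <- E) hs (Pi e *m A) = hs A.
Proof.
move=> Pp P1.
transitivity (\sum_(e <- E) \tr (A *m adjmx A *m Pi e)).
  by rewrite !big_seq; apply: eq_bigr => e /Pp; exact: hs_projl.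
by rewrite -(raddf_sum (@mxtrace _ m)) -mulmx_sumr P1 mulmx1.
Qed.

Lemma hs_resolutionr m n (E : seq R) (Pi : R -> 'M[C]_n) (A : 'M[C]_(m, n)) :
  (forall e, e \in E -> orth_proj (Pi e)) -> \sum_(e <- E) Pi e = 1%:M ->
  \sum_(e <- E) hs (A *m Pi e) = hs A.
Proof.
move=> Pp P1; rewrite -(hs_adj A) -(hs_resolutionl (adjmx A) Pp P1).
rewrite !big_seq; apply: eq_bigr => e /Pp[_ aP].
by rewrite -hs_adj adjmxM aP.
Qed.

Lemma hs_isol m n d (V : 'M[C]_(n, d)) (Q : 'M[C]_n) (A : 'M[C]_(n, m)) :
  orth_proj Q -> isometry_onto V Q -> hs (adjmx V *m A) <= hs A.
Proof.
move=> Qp [VV VQ]; apply: le_trans (le_hs_projl A Qp).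
rewrite hs_projl// -VQ /hs adjmxM adjmxK -!mulmxA mxtrace_mulC -!mulmxA.
by rewrite lexx.
Qed.

Lemma hs_isor m n d (V : 'M[C]_(n, d)) (Q : 'M[C]_n) (A : 'M[C]_(m, n)) :
  orth_proj Q -> isometry_onto V Q -> hs (A *m V) <= hs A.
Proof.
move=> Qp VQ; rewrite -hs_adj -(hs_adj A) adjmxM; exact: hs_isol VQ.
Qed.

Lemma mxtrace_CauchySchwarz m n (X Y : 'M[C]_(m, n)) :
  \tr (Y *m adjmx X) * conjc (\tr (Y *m adjmx X)) <= hs X * hs Y.
Proof.
set b := \tr _.
have bE : \tr (X *m adjmx Y) = conjc b.
  by rewrite /b -mxtrace_adj adjmxM adjmxK.
have expand l : hs (Y - l *: X) = hs Y - l * conjc b - conjc l * b + l * conjc l * hs X.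
  rewrite /hs adjmxD -scaleNr adjmxZ mulmxDl !mulmxDr !mxtraceD -!scalemxAr -!scalemxAl.
  rewrite !mxtraceZ bE -/b conjcN; move: (\tr _) (\tr _) => x y; ring.
have [X0|X0] := eqVneq (hs X) 0.
  have [b0|b0] := eqVneq (b * conjc b) 0; first by rewrite b0 mulr_ge0// hs_ge0.
  (* When [hs X = 0] the expansion at [l = r b] is [hs Y - 2 r |b|^2]; this [r] makes it
     [- hs Y - 2 |b|^2], which is negative. *)
  pose r := hs Y / (b * conjc b) + 1.
  have cY : conjc (hs Y) = hs Y by rewrite /hs -mxtrace_adj adjmxM adjmxK.
  have rr : conjc r = r.
    by rewrite /r conjcD conjc1 conjcM conjc_inv !conjcM conjcK cY [conjc b * b]mulrC.
  have := hs_ge0 (Y - (r * b) *: X); rewrite expand X0 mulr0 addr0 conjcM rr.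
  have -> : hs Y - r * b * conjc b - r * conjc b * b = - hs Y - 2 * (b * conjc b).
    have H : hs Y = (r - 1) * (b * conjc b) by rewrite /r addrK divfK.
    by rewrite H; clear; move: (r) (b) (conjc b) => x y z; ring.
  rewrite -opprD oppr_ge0 => le0.
  have := mulcJ_ge0 b; have Y0 := hs_ge0 Y; rewrite le0r (negbTE b0) /= => bb.
  by have := lt_le_trans (ltr_wpDl Y0 (mulr_gt0 (ltr0n C 2) bb)) le0; rewrite ltxx.
have Xp : 0 < hs X by rewrite lt0r X0 hs_ge0.
have cX : conjc (hs X) = hs X by rewrite /hs -mxtrace_adj adjmxM adjmxK.
have := hs_ge0 (Y - (b / hs X) *: X); rewrite expand conjcM conjc_inv cX.
have -> : hs Y - b / hs X * conjc b - conjc b / hs X * b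
    + b / hs X * (conjc b / hs X) * hs X = (hs X * hs Y - b * conjc b) / hs X.
  by clear -X0; move: X0; move: (hs X) (hs Y) (conjc b) (b) => x y z w x0; field.
by rewrite pmulr_lge0 ?invr_gt0// subr_ge0.
Qed.

(** * Energy blocks of a macroscopic projection *)

Section EnergyBlocks.
Variables (n d : nat) (V : 'M[C]_(n, d)) (Pmu Pnu : 'M[C]_n) (E : seq R)
  (Pi : R -> 'M[C]_n).
Hypotheses (Pmup : orth_proj Pmu) (Pnup : orth_proj Pnu) (VP : isometry_onto V Pmu)
  (uE : uniq E) (Pip : forall e, e \in E -> orth_proj (Pi e))
  (PiPi : forall e e', e \in E -> e' \in E -> e != e' -> Pi e *m Pi e' = 0)
  (Pi1 : \sum_(e <- E) Pi e = 1%:M).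

(** The compression to [C^d] turns [<psi_0, Pi_e P_nu Pi_e' psi_0>], with [psi_0 = V u], into a
    quadratic form in [u]. *)
Definition eblock e e' : 'M[C]_d := adjmx V *m (Pi e *m Pnu *m Pi e') *m V.

Lemma hs_isometry : hs V = d%:R.
Proof. by case: VP => VV _; rewrite /hs mxtrace_mulC VV mxtrace1. Qed.

Let Pi_sum f m (B : R -> 'M[C]_(n, m)) : f \in E ->
  Pi f *m (\sum_(e <- E) Pi e *m B e) = Pi f *m B f.
Proof.
move=> fE; rewrite mulmx_sumr (bigD1_seq f)//= mulmxA (Pip fE).1 big_seq_cond big1 ?addr0//.
by move=> e /andP[eE ef]; rewrite mulmxA PiPi ?mul0mx// eq_sym.
Qed.

Let diagE : \sum_(e <- E) eblock e e = adjmx V *m (\sum_(e <- E) Pi e *m (Pnu *m Pi e)) *m V.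
Proof.
rewrite mulmx_sumr mulmx_suml; apply: eq_bigr => e _; by rewrite /eblock !mulmxA.
Qed.

(** The energy projections split [hs V = d] into the pieces [hs (Pi_e V)], and [Pi_e P_nu] contracts
    each piece. *)
Lemma hs_diag_le_dmu : hs (\sum_(e <- E) eblock e e) <= d%:R.
Proof.
rewrite diagE -mulmxA; apply: le_trans (hs_isol _ Pmup VP) _.
rewrite -(hs_resolutionl _ Pip Pi1) -hs_isometry -(hs_resolutionl V Pip Pi1).
rewrite big_seq [leRHS]big_seq; apply: ler_sum => e eE.
rewrite mulmxA Pi_sum// -!mulmxA.
by apply: le_trans (le_hs_projl _ (Pip eE)) _; exact: le_hs_projl.
Qed.

(** Here both isometries are dropped, and it is [hs Pnu] that the energy projections split. *)
Lemma hs_diag_le_dnu : hs (\sum_(e <- E) eblock e e) <= \tr Pnu.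
Proof.
rewrite diagE -mulmxA; apply: le_trans (hs_isol _ Pmup VP) _.
apply: le_trans (hs_isor _ Pmup VP) _.
rewrite -(hs_resolutionl _ Pip Pi1) -(hs_orth_proj Pnup) -(hs_resolutionr Pnu Pip Pi1).
rewrite big_seq [leRHS]big_seq; apply: ler_sum => e eE.
by rewrite Pi_sum//; exact: le_hs_projl (Pip eE).
Qed.

Lemma sum_hs_le_dmu : \sum_(e <- E) \sum_(e' <- E) hs (eblock e e') <= d%:R.
Proof.
rewrite exchange_big /= -hs_isometry -(hs_resolutionl V Pip Pi1).
apply: le_trans (_ : \sum_(e' <- E) hs (Pnu *m (Pi e' *m V)) <= _); last first.
  by apply: ler_sum => e _; exact: le_hs_projl.
apply: ler_sum => e' _; rewrite -(hs_resolutionl (Pnu *m _) Pip Pi1).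
apply: ler_sum => e _; rewrite /eblock -!mulmxA; exact: hs_isol VP.
Qed.

Let blk P e e' : 'M[C]_n := Pi e *m P *m Pi e'.

Let sum_hs_blk P : \sum_(e <- E) \sum_(e' <- E) hs (blk P e e') = hs P.
Proof.
rewrite -(hs_resolutionl P Pip Pi1); apply: eq_bigr => e _.
by rewrite -(hs_resolutionr (Pi e *m P) Pip Pi1).
Qed.

Lemma sum_hs_le_dnu : \sum_(e <- E) \sum_(e' <- E) hs (eblock e e') <= \tr Pnu.
Proof.
rewrite -(hs_orth_proj Pnup) -sum_hs_blk.
apply: ler_sum => e _; apply: ler_sum => e' _; rewrite /eblock.
by apply: le_trans (hs_isor _ Pmup VP) _; exact: hs_isol VP.
Qed.

(** The trace is the Hilbert-Schmidt inner product of the [(e, e')] blocks of [Pnu] and [Pmu], so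
    Cauchy-Schwarz applies. *)
Let tr_le e e' : e \in E -> e' \in E ->
  \tr (eblock e e') * conjc (\tr (eblock e e')) <= hs (blk Pmu e e') * hs (blk Pnu e e').
Proof.
move=> eE e'E; apply: le_trans (mxtrace_CauchySchwarz _ _).
suff -> : \tr (eblock e e') = \tr (blk Pnu e e' *m adjmx (blk Pmu e e')) by [].
have [_ aPi] := Pip eE; have [PP' aPi'] := Pip e'E; have [PP _] := Pip eE.
have [_ aP] := Pmup; have [_ VVP] := VP.
transitivity (\tr (Pmu *m (Pi e *m Pnu *m Pi e'))).
  by rewrite /eblock [LHS]mxtrace_mulC -[in RHS]VVP !mulmxA.
rewrite /blk !adjmxM aPi aPi' aP mxtrace_mulC.
have -> : Pi e *m Pnu *m Pi e' *m (Pi e' *m (Pmu *m Pi e)) =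
    (Pi e *m Pnu *m Pi e' *m Pmu) *m Pi e.
  by rewrite -!mulmxA (mulmxA (Pi e') (Pi e')) PP'.
by rewrite [RHS]mxtrace_mulC !mulmxA PP.
Qed.

Let hs_blk_le P e e' : orth_proj P -> e \in E -> e' \in E -> hs (blk P e e') <= \tr (Pi e).
Proof.
move=> Pp eE e'E; rewrite -(hs_orth_proj (Pip eE)).
by apply: le_trans (le_hs_projr _ (Pip e'E)) _; exact: le_hs_projr.
Qed.

(** Of the two block norms given by Cauchy-Schwarz, that of [Pnu] is bounded by the degeneracy and
    that of [Pmu] is summed; the opposite choice yields [d_nu]. *)
Lemma sum_tr_le_dmu (D : C) : (forall e, e \in E -> \tr (Pi e) <= D) ->
  \sum_(e <- E) \sum_(e' <- E) \tr (eblock e e') * conjc (\tr (eblock e e'))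
  <= D * \tr Pmu.
Proof.
move=> HD; rewrite -(hs_orth_proj Pmup) -(sum_hs_blk Pmu) mulr_sumr.
rewrite big_seq [leRHS]big_seq; apply: ler_sum => e eE.
rewrite mulr_sumr big_seq [leRHS]big_seq; apply: ler_sum => e' e'E.
apply: le_trans (tr_le eE e'E) _; rewrite mulrC ler_wpM2r ?hs_ge0//.
by apply: le_trans (hs_blk_le _ _ _) (HD _ eE).
Qed.

Lemma sum_tr_le_dnu (D : C) : (forall e, e \in E -> \tr (Pi e) <= D) ->
  \sum_(e <- E) \sum_(e' <- E) \tr (eblock e e') * conjc (\tr (eblock e e'))
  <= D * \tr Pnu.
Proof.
move=> HD; rewrite -(hs_orth_proj Pnup) -(sum_hs_blk Pnu) mulr_sumr.
rewrite big_seq [leRHS]big_seq; apply: ler_sum => e eE.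
rewrite mulr_sumr big_seq [leRHS]big_seq; apply: ler_sum => e' e'E.
apply: le_trans (tr_le eE e'E) _; rewrite ler_wpM2r ?hs_ge0//.
by apply: le_trans (hs_blk_le _ _ _) (HD _ eE).
Qed.

End EnergyBlocks.

(** Removing the component along the identity lowers the norm by [|tr A|^2 / d]. *)
Lemma hs_traceless_le d (A : 'M[C]_d) : (0 < d)%N ->
  hs (A - (\tr A / d%:R)%:M) <= hs A.
Proof.
move=> d0; have dn0 : d%:R != 0 :> C by rewrite pnatr_eq0 -lt0n.
set m := \tr A / _; have trA : \tr A = m * d%:R by rewrite /m divfK.
have -> : hs (A - m%:M) = hs A - m * conjc m * d%:R.
  have -> : A - m%:M = A - m *: 1%:M by rewrite scalemx1.
  rewrite /hs adjmxD -scaleNr adjmxZ adjmx1 mulmxDl !mulmxDr !mxtraceD.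
  rewrite -!scalemxAr -!scalemxAl !mxtraceZ !mulmx1 !mul1mx mxtrace1 mxtrace_adj trA.
  rewrite conjcM conjc_nat conjcN; move: (\tr _) (conjc m) => x y; ring.
by rewrite gerBl mulr_ge0 ?ler0n// mulcJ_ge0.
Qed.

End HilbertSchmidt.

(** * Time averages of trigonometric sums *)

Section TimeAverage.
Context {R : realType}.
Implicit Types (f g : R -> R) (m w : R).

(* g is continuous and has an antiderivative which stays within a bounded
   distance of the line of slope m; in particular g has time average m. *)
Definition has_mean g m := continuous g /\
  exists F B, (forall t, is_derive t (1 : R) F (g t)) /\ (forall t, `|F t - m * t| <= B).

Lemma has_mean_cst m : has_mean (fun=> m) m.
Proof.
split; first by move=> t; exact: cvg_cst.
exists (m \*: id), 0; split=> [t|t]; last by rewrite /= subrr normr0.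
by apply: is_derive_eq; rewrite [_ *: _]mulr1.
Qed.

Lemma has_meanD f g m1 m2 : has_mean f m1 -> has_mean g m2 ->
  has_mean (fun t => f t + g t) (m1 + m2).
Proof.
move=> [cf [F [B [dF bF]]]] [cg [G [B' [dG bG]]]]; split.
  by move=> t; apply: cvgD; [exact: cf|exact: cg].
exists (F + G), (B + B'); split=> t; first exact: is_deriveD.
rewrite [X in `|X|](_ : _ = (F t - m1 * t) + (G t - m2 * t)).
  by rewrite (le_trans (ler_normD _ _))// lerD.
rewrite -[(F + G) t]/(F t + G t); ring.
Qed.

Lemma has_meanZ c f m : has_mean f m -> has_mean (fun t => c * f t) (c * m).
Proof.
move=> [cf [F [B [dF bF]]]]; split.
  by move=> t; apply: cvgM; [exact: cvg_cst|exact: cf].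
exists (c \*: F), (`|c| * B); split=> t; first exact: is_deriveZ.
by rewrite -mulrA -[(c \*: F) t]/(c * F t) -mulrBr normrM ler_wpM2l.
Qed.

Lemma has_mean_sum (I : Type) (r : seq I) (f : I -> R -> R) (m : I -> R) :
  (forall i, has_mean (f i) (m i)) ->
  has_mean (fun t => \sum_(i <- r) f i t) (\sum_(i <- r) m i).
Proof.
move=> H; elim: r => [|i r IH].
  by under eq_fun do rewrite big_nil; rewrite big_nil; exact: has_mean_cst.
by under eq_fun do rewrite big_cons; rewrite big_cons; exact: has_meanD.
Qed.

Let cvg_scale (h : R -> R) w : continuous h -> continuous (fun t => h (w * t)).
Proof.
move=> ch t; apply: (@continuous_comp _ _ _ (fun t => w * t) h); last exact: ch.
by apply: cvgM; [exact: cvg_cst|exact: cvg_id].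
Qed.

Let is_derive_scale (h : R -> R) dh w t : is_derive (w * t) (1 : R) h dh ->
  is_derive t (1 : R) (h \o (w \*: id)) (dh * w).
Proof.
move=> Hh; apply: is_derive1_comp.
by apply: is_derive_eq; rewrite [_ *: _]mulr1.
Qed.

Lemma has_mean_cos w : has_mean (fun t => cos (w * t)) (w == 0)%:R.
Proof.
have [->|w0] := eqVneq w 0.
  by under eq_fun do rewrite mul0r cos0; exact: has_mean_cst.
split; first by apply: cvg_scale; exact: continuous_cos.
exists (w^-1 \*: (sin \o (w \*: id))), `|w^-1|; split=> t.
  have H := is_deriveZ w^-1 (is_derive_scale (is_derive_sin (w * t))).
  by apply: (is_derive_eq H); rewrite -[LHS]/(w^-1 * _) mulrCA mulVf ?mulr1.
rewrite mul0r subr0 -[X in `|X|]/(w^-1 * sin (w * t)) normrM ler_piMr//.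
by rewrite ler_norml sin_geN1 sin_le1.
Qed.

Lemma has_mean_sin w : has_mean (fun t => sin (w * t)) 0.
Proof.
have [->|w0] := eqVneq w 0.
  by under eq_fun do rewrite mul0r sin0; exact: has_mean_cst.
split; first by apply: cvg_scale; exact: continuous_sin.
exists (- w^-1 \*: (cos \o (w \*: id))), `|w^-1|; split=> t.
  have H := is_deriveZ (- w^-1) (is_derive_scale (is_derive_cos (w * t))).
  by apply: (is_derive_eq H); rewrite -[LHS]/(- w^-1 * (- sin (w * t) * w)); field.
rewrite mul0r subr0 -[X in `|X|]/(- w^-1 * cos (w * t)) normrM normrN ler_piMr//.
by rewrite ler_norml cos_geN1 cos_le1.
Qed.

Lemma has_mean_integral g m : has_mean g m ->
  exists B, forall T, 0 < T ->
    (\int[lebesgue_measure]_(t in `[0%R, T]) (g t)%:E <= (m * T + B)%:E)%E.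
Proof.
move=> [cg [F [B [dF bF]]]]; exists (B + B) => T T0.
have cF : continuous F.
  move=> t; apply/differentiable_continuous/derivable1_diffP.
  exact: (@ex_derive _ _ _ _ _ _ _ (dF t)).
rewrite (@continuous_FTC2 _ g F)//.
- rewrite -EFinB lee_fin; have := bF T; have := bF 0.
  by rewrite mulr0 !subr0 !ler_norml => /andP[H1 H2] /andP[H3 H4]; lra.
- by apply: continuous_subspaceT => t; exact: cg.
- split=> [t _||].
  + exact: (@ex_derive _ _ _ _ _ _ _ (dF t)).
  + apply: cvg_at_right_filter; exact: cF.
  + apply: cvg_at_left_filter; exact: cF.
- by move=> t _; rewrite derive1E (@derive_val _ _ _ _ _ _ _ (dF t)).
Qed.

(** Chebyshev on [[0, T]]: the times with [|f| > K] have measure at most [(G T + B) / K^2], and [B]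
    is negligible against [T]. *)
Lemma most_times_mean_square f K delta G : continuous f -> 0 < K ->
  has_mean (fun t => f t ^+ 2) G -> G <= delta * K ^+ 2 ->
  most_times (fun t => `|f t| <= K) delta.
Proof.
move=> cf K0 hG Gle; have [B HB] := has_mean_integral hG.
rewrite /most_times limf_einfE; apply/lee_addgt0Pr => eta eta0.
have K20 : 0 < K ^+ 2 by rewrite exprn_gt0.
have eK : 0 < eta * K ^+ 2 by rewrite mulr_gt0.
(* Beyond [T0] the share of [B] is below [eta]; the half-line past [T0] is the neighborhood of
   infinity that bounds the lower limit. *)
pose T0 : R := Num.max 0 (B / (eta * K ^+ 2)).
rewrite -leeBlDr//; apply: le_ereal_sup_tmp.
exists (ereal_inf [set ((T^-1)%:E * lebesgue_measure
   [set t : R | (0 <= t <= T)%R /\ (`|f t| <= K)%R])%E | T in [set T : R | (T0 < T)%R]]).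
  exists [set T : R | T0 < T] => //.
  by exists T0; split=> //; exact: num_real.
apply: le_ereal_inf_tmp => _ [T /= TT0 <-].
have [Tp TB] : 0 < T /\ B < T * (eta * K ^+ 2).
  by move: TT0; rewrite /T0 gt_max => /andP[? ?]; rewrite -ltr_pdivrMr.
pose D : set R := `[0%R, T]%classic.
have mD : measurable D by exact: measurable_itv.
pose A : set R := [set t | ((K ^+ 2)%:E <= `|(f t ^+ 2)%:E|)%E].
have mf2 : measurable_fun setT (fun t => f t ^+ 2).
  by apply: measurable_funX; exact: continuous_measurable_fun.
have mA : measurable (D `&` A).
  rewrite /A (_ : [set t | _] = (fun t => f t ^+ 2) @^-1` `[K ^+ 2, +oo[); last first.
    by apply/seteqP; split=> t /=; rewrite in_itv/= andbT lee_fin ger0_norm ?sqr_ge0.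
  apply: measurableI; first exact: measurable_itv.
  by rewrite -[X in measurable X]setTI; apply: mf2 => //; exact: measurable_itv.
have mS : measurable [set t : R | (0 <= t <= T)%R /\ (`|f t| <= K)%R].
  rewrite (_ : [set t | _] = D `&` (fun t => `|f t|) @^-1` `]-oo, K]); last first.
    by apply/seteqP; split=> t /=; rewrite /D/= !in_itv.
  apply: measurableI; first exact: measurable_itv.
  rewrite -[X in measurable X]setTI.
  have mn : measurable_fun setT (fun t => `|f t|).
    by apply: measurableT_comp => //; exact: continuous_measurable_fun.
  by apply: mn => //; exact: measurable_itv.
have lebD : lebesgue_measure D = T%:E.
  by rewrite lebesgue_measure_itv/= lte_fin Tp sube0.
have mark : ((K ^+ 2)%:E * lebesgue_measure (D `&` A) <= (G * T + B)%:E)%E.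
  apply: le_trans (HB T Tp).
  have := @le_integral_comp_abse _ _ R lebesgue_measure D (measurable_itv _)
    (EFin \o (fun t => f t ^+ 2)) (K ^+ 2) id.
  move=> /(_ (@measurable_id _ _ _)) H; apply: le_trans (H _ _ _ K20) _ => //.
    by apply/measurable_EFinP; exact: measurable_funTS.
  rewrite le_eqVlt; apply/orP; left; apply/eqP.
  by apply: eq_integral => t _ /=; rewrite ger0_norm// sqr_ge0.
have [b bE] : exists b, lebesgue_measure (D `&` A) = b%:E.
  exists (fine (lebesgue_measure (D `&` A))); rewrite fineK// ge0_fin_numE//.
  apply: le_lt_trans (ltry T); rewrite -lebD; apply: le_measure; rewrite ?inE//.
rewrite bE -EFinM lee_fin in mark.
have sub : ((T - b)%:E <= lebesgue_measure [set t : R | (0 <= t <= T)%R /\ (`|f t| <= K)%R])%E.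
  have -> : (T - b)%:E = lebesgue_measure (D `\` (D `&` A)).
    have finD : (lebesgue_measure D < +oo)%E by rewrite lebD ltry.
    have -> : lebesgue_measure (D `\` (D `&` A)) =
        (lebesgue_measure D - lebesgue_measure (D `&` (D `&` A)))%E.
      exact: measureD.
    by rewrite setIA setIid bE lebD -EFinB.
  apply: le_measure; rewrite ?inE//; first exact: measurableD.
  move=> t [tD nA]; split; first by move: tD; rewrite /D/= in_itv.
  rewrite leNgt; apply/negP => Kf; apply: nA; split=> //.
  by rewrite /A/= lee_fin ger0_norm ?sqr_ge0// -[leRHS]real_normK ?num_real// ler_pXn2r ?nnegrE ?(ltW K0) ?(ltW Kf).
apply: (@le_trans _ _ ((T^-1)%:E * (T - b)%:E)%E); last first.
  by rewrite lee_pmul2l// lte_fin invr_gt0.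
have bT : b <= T * (delta + eta).
  rewrite -(ler_pM2l K20); apply: le_trans mark _.
  have := ler_wpM2r (ltW Tp) Gle; nra.
rewrite -EFinM -EFinB lee_fin mulrBr mulVf ?gt_eqF//.
have : T^-1 * b <= delta + eta by rewrite mulrC ler_pdivrMr// mulrC.
lra.
Qed.

End TimeAverage.

(** * Mean squares and gap degeneracy *)

Section TrigonometricSums.
Context {R : realType}.
Local Notation C := R[i].
Local Notation Re := (@complex.Re R).
Local Notation Im := (@complex.Im R).

Lemma Re_sum (I : Type) (r : seq I) (F : I -> C) :
  Re (\sum_(i <- r) F i) = \sum_(i <- r) Re (F i).
Proof. by apply: (big_morph Re (@ReD R)). Qed.

Lemma expiD (x y : R) : expi (x + y) = expi x * expi y.
Proof.
by apply/eqP; rewrite eq_complex /= sinD cosD; apply/andP; split; apply/eqP; ring.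
Qed.

Lemma expi0 : expi 0 = 1 :> C.
Proof. by rewrite /expi cos0 sin0. Qed.

Lemma conjc_expi (x : R) : conjc (expi x) = expi (- x).
Proof. by rewrite /expi cosN sinN. Qed.

Lemma has_mean_Re_expi (a : C) (w : R) :
  has_mean (fun t => Re (a * expi (w * t))) ((w == 0)%:R * Re a).
Proof.
under eq_fun do rewrite ReM /=.
rewrite -[X in has_mean _ X]addr0 -[X in _ + X](mulr0 (- Im a)) [_%:R * _]mulrC.
under eq_fun do rewrite -mulNr.
by apply: has_meanD; apply: has_meanZ; [exact: has_mean_cos|exact: has_mean_sin].
Qed.

Section Square.
Variables (I : Type) (r : seq I) (c : I -> C) (w : I -> R) (f : R -> R).
Hypothesis fE : forall t, (f t)%:C%C = \sum_(i <- r) c i * expi (w i * t).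

Lemma trig_sum_continuous : continuous f.
Proof.
have -> : f = fun t => \sum_(i <- r) Re (c i * expi (w i * t)).
  by apply/funext => t; rewrite -Re_sum -fE.
by have [] := has_mean_sum r (fun i => has_mean_Re_expi (c i) (w i)).
Qed.

(** As [f] is real, [f^2 = f conj(f)] has the frequencies [w_i - w_j], and only the zero ones have
    nonzero mean. Frequencies may repeat, hence the double sum. *)
Lemma trig_sum_mean_square : has_mean (fun t => f t ^+ 2)
  (\sum_(i <- r) \sum_(j <- r) (w i == w j)%:R * Re (c i * conjc (c j))).
Proof.
have -> : (fun t => f t ^+ 2) = fun t => \sum_(i <- r) \sum_(j <- r)
    Re (c i * conjc (c j) * expi ((w i - w j) * t)).
  apply/funext => t; transitivity (Re ((f t)%:C%C * conjc (f t)%:C%C)).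
    by rewrite ReM /= oppr0 mul0r subr0.
  rewrite fE conjc_sum big_distrlr /= Re_sum; apply: eq_bigr => i _.
  rewrite Re_sum; apply: eq_bigr => j _; congr Re.
  by rewrite conjcM conjc_expi mulrBl expiD; ring.
apply: has_mean_sum => i; apply: has_mean_sum => j.
by rewrite -subr_eq0; exact: has_mean_Re_expi.
Qed.

End Square.

Definition gap_pairs (E : seq R) : seq (R * R) :=
  [seq x <- allpairs pair E E | x.1 != x.2].

Lemma gap_countE (E : seq R) g : gap_count E g = count (fun x => x.1 - x.2 == g) (gap_pairs E).
Proof. by rewrite count_filter; apply: eq_count => x /=; rewrite andbC. Qed.

Lemma gap_count_le_DG (E : seq R) x : x \in gap_pairs E -> (gap_count E (x.1 - x.2) <= DG E)%N.
Proof.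
rewrite mem_filter => /andP[_ xE].
apply: (@leq_bigmax_seq _ _ xpredT (gap_count E) (x.1 - x.2)) => //.
by apply/mapP; exists x.
Qed.

(* Schur test: each gap occurs at most DG times. *)
Lemma gap_sum_le (E : seq R) (c : R * R -> C) :
  \sum_(x <- gap_pairs E) \sum_(y <- gap_pairs E)
    (x.1 - x.2 == y.1 - y.2)%:R * Re (c x * conjc (c y))
  <= (DG E)%:R * \sum_(x <- gap_pairs E) Re (c x * conjc (c x)).
Proof.
set S := gap_pairs E; pose N x := Re (c x * conjc (c x)).
pose k (x y : R * R) : R := (x.1 - x.2 == y.1 - y.2)%:R.
have N0 x : 0 <= N x by rewrite /N ReM; case: (c x) => a b /=; nra.
(* [Re (x conj(y)) <= (|x|^2 + |y|^2) / 2]; by symmetry of the kernel the two halves have equal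
   sums. *)
apply: (@le_trans _ _ (\sum_(x <- S) \sum_(y <- S) (k x y * N x / 2 + k x y * N y / 2))).
  apply: ler_sum => x _; apply: ler_sum => y _; rewrite -!mulrA -mulrDr.
  rewrite ler_wpM2l ?ler0n// /N !ReM; case: (c x) (c y) => a b [a' b'] /=.
  have := sqr_ge0 (a - a'); have := sqr_ge0 (b - b'); nra.
under eq_bigr do rewrite big_split /=.
rewrite big_split /= [X in _ + X]exchange_big /=.
have -> : \sum_(j <- S) \sum_(i <- S) k i j * N j / 2 = \sum_(i <- S) \sum_(j <- S) k i j * N i / 2.
  by apply: eq_bigr => i _; apply: eq_bigr => j _; rewrite /k eq_sym.
rewrite -big_split /= mulr_sumr big_seq [leRHS]big_seq; apply: ler_sum => x xS.
rewrite -big_split /=.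
have -> : \sum_(y <- S) (k x y * N x / 2 + k x y * N x / 2) = (gap_count E (x.1 - x.2))%:R * N x.
  rewrite gap_countE -/S -sum1_count natr_sum [in RHS]big_mkcond /= mulr_suml.
  apply: eq_bigr => y _; rewrite -splitr /k eq_sym; by case: ifP.
by rewrite ler_wpM2r// ler_nat gap_count_le_DG.
Qed.

End TrigonometricSums.

(** * Fluctuations of the macroscopic weight *)

Section Typicality.
Context {R : realType}.
Local Notation C := R[i].
Local Notation Re := (@complex.Re R).

Lemma normsqE n (v : 'cV[C]_n) : (normsq v)%:C%C = (adjmx v *m v) 0 0.
Proof.
rewrite mxE /normsq rmorph_sum; apply: eq_bigr => i _; rewrite !mxE /=.
by case: (v i 0) => a b; apply/eqP; rewrite eq_complex /=; apply/andP; split; apply/eqP; ring.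
Qed.

Definition unit_vec d (s : seqM R) : 'cV[C]_d := \col_j ucoord d j s.

Lemma unit_vecE d (s : seqM R) :
  ((Num.sqrt (normsq (cvec_of_coords d s)))^-1)%:C%C *: cvec_of_coords d s = unit_vec d s.
Proof. by apply/matrixP => j k; rewrite !mxE ucoordE. Qed.

Lemma qformE d (A : 'M[C]_d) s : qform A s = (adjmx (unit_vec d s) *m A *m unit_vec d s) 0 0.
Proof.
rewrite mxE; under eq_bigr do rewrite mxE mulr_suml.
rewrite exchange_big pair_bigA /qform /=; apply: eq_bigr => -[i j] _ /=.
by rewrite !mxE; ring.
Qed.

Lemma qform_sum d (I : Type) (r : seq I) (A : I -> 'M[C]_d) s :
  qform (\sum_(i <- r) A i) s = \sum_(i <- r) qform (A i) s.
Proof.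
by rewrite qformE mulmx_sumr mulmx_suml summxE; apply: eq_bigr => i _; rewrite qformE.
Qed.

Lemma qform_scalar d (c : C) s : sphere_dom d s -> qform (c%:M : 'M[C]_d) s = c.
Proof.
move=> Ds; rewrite qformE -scalemx1 -scalemxAr -scalemxAl mulmx1 !mxE.
rewrite -[RHS]mulr1; congr (_ * _); rewrite -(sum_ucoord Ds).
by apply: eq_bigr => j _; rewrite !mxE.
Qed.

Lemma qformB d (A B : 'M[C]_d) s : qform (A - B) s = qform A s - qform B s.
Proof. by rewrite !qformE mulmxBr mulmxBl !mxE. Qed.

(** * The macroscopic weight as a trigonometric sum *)

Section Dynamics.
Variables (n d : nat) (V : 'M[C]_(n, d)) (Pmu Pnu : 'M[C]_n) (E : seq R)
  (Pi : R -> 'M[C]_n).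
Hypotheses (Pmup : orth_proj Pmu) (Pnup : orth_proj Pnu) (VP : isometry_onto V Pmu)
  (uE : uniq E) (Pip : forall e, e \in E -> orth_proj (Pi e))
  (PiPi : forall e e', e \in E -> e' \in E -> e != e' -> Pi e *m Pi e' = 0)
  (Pi1 : \sum_(e <- E) Pi e = 1%:M).
Local Notation blk := (eblock V Pnu Pi).

Lemma normsq_evol t s :
  (normsq (Pnu *m (evol E Pi t *m (V *m unit_vec d s))))%:C%C =
  \sum_(e <- E) \sum_(e' <- E) qform (blk e e') s * expi ((e - e') * t).
Proof.
set x := V *m _; have [PP aP] := Pnup.
have evE : evol E Pi t *m x = \sum_(e <- E) expi (- (e * t)) *: (Pi e *m x).
  by rewrite /evol mulmx_suml; apply: eq_bigr => e _; rewrite scalemxAl.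
rewrite normsqE adjmxM aP -!mulmxA (mulmxA Pnu Pnu) PP evE adjmx_sum.
rewrite mulmx_suml summxE big_seq [RHS]big_seq; apply: eq_bigr => e eE.
rewrite !mulmx_sumr summxE big_seq [RHS]big_seq; apply: eq_bigr => e' e'E.
have [_ aPi] := Pip eE.
have ZE (a : C) (B : 'M[C]_1) : (a *: B) 0 0 = a * B 0 0 by rewrite mxE.
rewrite adjmxZ conjc_expi opprK -!scalemxAr -!scalemxAl !ZE.
rewrite qformE mulrBl expiD /eblock adjmxM aPi /x adjmxM !mulmxA.
by move: (fun_of_matrix _ 0 0) => z; ring.
Qed.

Definition Mval : R := Re (d%:R^-1 * \sum_(e <- E) \tr (Pmu *m Pi e *m Pnu *m Pi e)).

Lemma tr_eblock e e' : \tr (blk e e') = \tr (Pmu *m Pi e *m Pnu *m Pi e').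
Proof.
by case: VP => _ VVP; rewrite /eblock [LHS]mxtrace_mulC -[in RHS]VVP !mulmxA.
Qed.

Lemma Mval_real :
  Mval%:C%C = d%:R^-1 * \sum_(e <- E) \tr (Pmu *m Pi e *m Pnu *m Pi e).
Proof.
rewrite /Mval; set z := d%:R^-1 * _; suff : conjc z = z.
  by case: z => a b [/eqP]; rewrite eq_sym -subr_eq0 opprK -mulr2n mulrn_eq0 /= => /eqP ->.
rewrite /z conjcM conjc_inv conjc_nat conjc_sum; congr (_ * _).
rewrite big_seq [RHS]big_seq; apply: eq_bigr => e eE.
rewrite -mxtrace_adj !adjmxM (Pip eE).2 Pmup.2 Pnup.2.
by rewrite mxtrace_mulC !mulmxA mxtrace_mulC !mulmxA mxtrace_mulC !mulmxA mxtrace_mulC !mulmxA.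
Qed.

Definition dev : 'M[C]_d := \sum_(e <- E) blk e e - (Mval%:C%C)%:M.

Hypothesis d_gt0 : (0 < d)%N.
Let dn0 : d%:R != 0 :> C. Proof. by rewrite pnatr_eq0 -lt0n. Qed.

(** [M] is exactly the normalized trace of the diagonal part, so [dev] is its traceless part. *)
Lemma devE : dev = \sum_(e <- E) blk e e - (\tr (\sum_(e <- E) blk e e) / d%:R)%:M.
Proof.
congr (_ - _%:M); rewrite Mval_real mulrC raddf_sum; congr (_ / _).
by apply: eq_bigr => e _; rewrite /= tr_eblock.
Qed.

Lemma dev_tr0 : \tr dev = 0.
Proof. by rewrite devE raddfB /= mxtrace_scalar -[X in _ - X]mulr_natr divfK// subrr. Qed.

Lemma gap_pairs_sum (U : nmodType) (F : R * R -> U) :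
  \sum_(x <- gap_pairs E) F x = \sum_(e <- E) \sum_(e' <- E | e != e') F (e, e').
Proof.
rewrite big_filter big_mkcond big_allpairs.
by apply: eq_bigr => e _; rewrite -big_mkcond.
Qed.

(** Restoring the diagonal pairs makes the full resolutions of the identity available. *)
Lemma le_gap_pairs_sum (F : R * R -> C) : (forall x, 0 <= F x) ->
  \sum_(x <- gap_pairs E) F x <= \sum_(e <- E) \sum_(e' <- E) F (e, e').
Proof.
move=> F0; rewrite gap_pairs_sum; apply: ler_sum => e _.
by rewrite [leRHS](bigID (fun e' => e != e')) /= lerDl sumr_ge0.
Qed.

(** [None] indexes the constant term, so that a single trigonometric sum represents the whole
    fluctuation. *)
Let c s (o : option (R * R)) : C :=
  if o is Some x then qform (blk x.1 x.2) s else qform dev s.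
Let w (o : option (R * R)) : R := if o is Some x then x.1 - x.2 else 0.
Let idx := None :: map Some (gap_pairs E).

Definition fluct s t : R := normsq (Pnu *m (evol E Pi t *m (V *m unit_vec d s))) - Mval.

Lemma fluctE s t : sphere_dom d s ->
  (fluct s t)%:C%C = \sum_(o <- idx) c s o * expi (w o * t).
Proof.
move=> Ds; rewrite /fluct rmorphB /= normsq_evol big_cons big_map /= gap_pairs_sum.
rewrite mul0r.
rewrite expi0 [qform dev s * 1]mulr1 qformB qform_sum qform_scalar// addrAC.
congr (_ - _); rewrite -big_split /= big_seq [RHS]big_seq.
apply: eq_bigr => e eE; rewrite (bigD1_seq e)//=.
rewrite [X in X + _ = _](_ : _ = qform (blk e e) s); last first.
  by rewrite subrr mul0r expi0 [LHS]mulr1.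
under eq_bigl do rewrite eq_sym.
by [].
Qed.

Definition sqmod (A : 'M[C]_d) s : C := qform A s * conjc (qform A s).

Definition fluct_bound s : C :=
  sqmod dev s + (DG E)%:R * \sum_(x <- gap_pairs E) sqmod (blk x.1 x.2) s.

Lemma mean_square_le s :
  \sum_(o <- idx) \sum_(o' <- idx) (w o == w o')%:R * Re (c s o * conjc (c s o'))
  <= Re (fluct_bound s).
Proof.
have wn0 x : x \in gap_pairs E -> (x.1 - x.2 == 0) = false.
  by rewrite mem_filter subr_eq0 => /andP[/negbTE].
rewrite big_cons big_cons big_map /= eqxx mul1r.
have -> : \sum_(j <- gap_pairs E) (0 == j.1 - j.2)%:R *
    Re (qform dev s * conjc (qform (blk j.1 j.2) s)) = 0.
  by rewrite big_seq big1// => x xE; rewrite eq_sym wn0// mul0r.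
rewrite addr0 /fluct_bound ReD; apply: lerD => //; rewrite big_map.
have -> : Re ((DG E)%:R * \sum_(x <- gap_pairs E) sqmod (blk x.1 x.2) s) =
    (DG E)%:R * \sum_(x <- gap_pairs E) Re (sqmod (blk x.1 x.2) s).
  rewrite -Re_sum -(rmorph_nat (real_complex R)) ReM /= mul0r subr0 //.
apply: le_trans (gap_sum_le E (fun x => qform (blk x.1 x.2) s)).
rewrite big_seq [leRHS]big_seq; apply: ler_sum => x xE.
by rewrite big_cons big_map /= wn0// mul0r add0r.
Qed.

Lemma most_times_fluct s K delta : sphere_dom d s -> 0 < K ->
  Re (fluct_bound s) <= delta * K ^+ 2 ->
  most_times (fun t => `|fluct s t| <= K) delta.
Proof.
move=> Ds K0 Hle; have fE t := fluctE t Ds.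
apply: (most_times_mean_square (trig_sum_continuous fE) K0 (trig_sum_mean_square fE)).
exact: le_trans (mean_square_le s) Hle.
Qed.

Lemma cbmeas_sqmod A : cbmeas (sqmod A).
Proof. by apply: cbmeasM; [|apply: cbmeas_conj]; exact: cbmeas_qform. Qed.

Lemma cbmeas_fluct_bound : cbmeas fluct_bound.
Proof.
apply: cbmeasD; first exact: cbmeas_sqmod.
apply: cbmeasM; first exact: cbmeas_cst.
by apply: cbmeas_sum => x; exact: cbmeas_sqmod.
Qed.

Local Notation vol := (@leb_seq R (2 * d)).

Let tr_Pi_ge0 e : e \in E -> 0 <= \tr (Pi e).
Proof. by move=> eE; rewrite -(hs_orth_proj (Pip eE)) hs_ge0. Qed.

Lemma tr_le_DE e : e \in E -> \tr (Pi e) <= (DE E Pi)%:C%C.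
Proof.
move=> eE; rewrite lecE (ger0_Im (tr_Pi_ge0 eE)) eqxx /=.
by apply: (@le_bigmax_seq _ _ _ _ 0 e xpredT (fun e => Re (\tr (Pi e)))).
Qed.

(** The common bound [m] stands for [min(d_mu, d_nu)], so that both dimensions are handled in one
    computation. *)
Lemma sphere_int_fluct_bound_le (m : C) : 0 <= m ->
  (hs (\sum_(e <- E) blk e e) <= m) ->
  (\sum_(e <- E) \sum_(e' <- E) hs (blk e e') <= m) ->
  (\sum_(e <- E) \sum_(e' <- E) \tr (blk e e') * conjc (\tr (blk e e')) <= (DE E Pi)%:C%C * m) ->
  sphere_int d fluct_bound <= (fine (vol (sphere_dom d)) / (d * d.+1)%:R)%:C%C *
    (m + (DG E)%:R * ((DE E Pi)%:C%C * m + m)).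
Proof.
move=> m0 h1 h2 h3; have cs := cbmeas_sqmod.
rewrite sphere_intD//; last first.
  by apply: cbmeasM; [exact: cbmeas_cst|apply: cbmeas_sum => x; exact: cs].
rewrite sphere_intZ; last by apply: cbmeas_sum => x; exact: cs.
rewrite sphere_int_sum; last by move=> x; exact: cs.
rewrite /sqmod sphere_int_qform -hsE dev_tr0 mul0r add0r.
set beta := (_%:C)%C.
have b0 : 0 <= beta.
  by rewrite ler0c divr_ge0 ?ler0n// fine_ge0.
under eq_bigr do rewrite sphere_int_qform -hsE.
rewrite -mulr_sumr mulrCA -mulrDr; apply: ler_wpM2l => //.
apply: lerD.
  by apply: le_trans h1; rewrite devE; exact: hs_traceless_le.
apply: ler_wpM2l; first exact: ler0n.
rewrite big_split /=; apply: lerD.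
  by apply: le_trans h3; apply: le_gap_pairs_sum => x; exact: mulcJ_ge0.
by apply: le_trans h2; apply: le_gap_pairs_sum => x; exact: hs_ge0.
Qed.

End Dynamics.
End Typicality.

(** * Markov on the sphere and the final estimate *)

Section Main.
Context {R : realType}.
Local Notation C := R[i].
Local Notation Re := (@complex.Re R).

Lemma leb_seq_fine_gt0 d : (0 < d)%N -> 0 < fine (@leb_seq R (2 * d) (sphere_dom d)).
Proof. by move=> d0; rewrite fine_gt0// sphere_dom_gt0// sphere_dom_fin. Qed.

Lemma cone_volE n d (V : 'M[C]_(n, d)) (A : set 'cV[C]_n) :
  cone_vol V A = @leb_seq R (2 * d) [set s | sphere_dom d s /\ A (V *m unit_vec d s)].
Proof.
rewrite /cone_vol /leb_seq; congr iter_leb; apply/funext => s.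
by congr (\1_ _ s)%:E; apply/funext => s'; rewrite /= unit_vecE.
Qed.

(* Markov's inequality on the ball. Monotonicity of the iterated integral needs no
   measurability, so A may be an arbitrary set. *)
Lemma unif_sphere_ge n d (V : 'M[C]_(n, d)) (A : set 'cV[C]_n) (F : seqM R -> C)
    (c eps : R) : (0 < d)%N -> 0 < c -> cbmeas F -> (forall s, 0 <= Re (F s)) ->
  Re (sphere_int d F) <= c * eps * fine (@leb_seq R (2 * d) (sphere_dom d)) ->
  (forall s, sphere_dom d s -> Re (F s) < c -> A (V *m unit_vec d s)) ->
  ((1 - eps)%:E <= unif_sphere V A)%E.
Proof.
move=> d0 c0 [bF _] F0 HF HA.
set vol := @leb_seq R (2 * d); set D := @sphere_dom R d; set v := fine _ in HF.
have mD : measurable D := @measurable_sphere_dom R d.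
have v0 : 0 < v := leb_seq_fine_gt0 d0.
have volD : vol D = v%:E by rewrite /v fineK// ge0_fin_numE ?sphere_dom_fin.
have [mF _] := bF.
pose B : set (seqM R) := [set s | (c%:E <= `|(Re (F s))%:E|)%E].
have mB : measurable (D `&` B).
  rewrite /B (_ : [set s | _] = (fun s => Re (F s)) @^-1` `[c, +oo[); last first.
    by apply/seteqP; split=> s /=; rewrite in_itv/= andbT lee_fin ger0_norm.
  apply: measurableI => //.
  by rewrite -[X in measurable X]setTI; apply: mF => //; exact: measurable_itv.
have intF := bmeas_integrable d bF.
have mark : (c%:E * vol (D `&` B) <= (c * eps * v)%:E)%E.
  apply: (@le_trans _ _ (Re (sphere_int d F))%:E); last by rewrite lee_fin.
  rewrite /sphere_int /= /Rintegral fineK; last exact: integrable_fin_num.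
  have := @le_integral_comp_abse _ _ R vol D mD (EFin \o (fun s => Re (F s))) c id.
  move=> /(_ (@measurable_id _ _ _)) H; apply: le_trans (H _ _ _ c0) _ => //.
    by apply/measurable_EFinP; exact: measurable_funTS.
  rewrite le_eqVlt; apply/orP; left; apply/eqP.
  by apply: eq_integral => s _ /=; rewrite ger0_norm.
have bad : (vol (D `&` B) <= (eps * v)%:E)%E.
  by rewrite -(@lee_pmul2l _ c%:E)// -EFinM mulrA.
have finD : (vol D < +oo)%E by rewrite volD ltry.
have good : ((v - eps * v)%:E <= vol (D `\` (D `&` B)))%E.
  have -> : vol (D `\` (D `&` B)) = (vol D - vol (D `&` (D `&` B)))%E by exact: measureD.
  by rewrite setIA setIid volD EFinB; apply: leeB.
rewrite /unif_sphere !cone_volE.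
have -> : [set s : seqM R | sphere_dom d s /\ setT (V *m unit_vec d s)] = D.
  by apply/seteqP; split=> s //= [].
rewrite -/vol -/D -/v lee_pdivlMr// -EFinM.
apply: (@le_trans _ _ (v - eps * v)%:E); first by rewrite lee_fin mulrBl mul1r.
apply: le_trans good _; apply: le_leb_seq => s [Ds nB]; split=> //.
apply: HA => //; rewrite ltNge; apply/negP => cF; apply: nB; split=> //.
by rewrite /B/= lee_fin ger0_norm.
Qed.

Lemma most_times_all (S : R -> Prop) delta : 0 < delta -> (forall t, S t) -> most_times S delta.
Proof.
move=> d0 HS.
have H : has_mean (fun t : R => (0 : R) ^+ 2) 0 by rewrite expr0n; exact: has_mean_cst.
have := @most_times_mean_square R (fun=> 0) 1 delta 0 _ ltr01 H.
have -> : (fun t : R => `|0 : R| <= (1 : R) : Prop) = S.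
  apply/funext => t; apply/propext; split=> // _; by rewrite normr0 ler01.
apply; first by move=> t; exact: cvg_cst.
by rewrite expr1n mulr1 ltW.
Qed.

Lemma typicality_arith (v d D G m : R) : 0 < v -> 1 <= d -> 1 <= D -> 1 <= G -> 0 <= m ->
  v / (d * (d + 1)) * (m + G * (D * m + m)) <= 16 * (D * G * m / d ^+ 2) * v.
Proof.
move=> v0 d1 D1 G1 m0; set Y := D * G * m.
have d0 : 0 < d by lra.
have GD : 1 <= D * G by nra.
have Y1 : m <= Y by rewrite ler_peMl.
have Y2 : G * m <= Y by rewrite /Y -mulrA ler_peMl// mulr_ge0//; lra.
have Y0 : 0 <= Y by lra.
have le3 : m + G * (D * m + m) <= 3 * Y.
  have -> : G * (D * m + m) = Y + G * m by rewrite /Y; ring.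
  lra.
apply: (@le_trans _ _ (v / (d * (d + 1)) * (3 * Y))).
  by apply: ler_wpM2l => //; rewrite divr_ge0 ?mulr_ge0//; lra.
have -> : 16 * (Y / d ^+ 2) * v = v / d ^+ 2 * (16 * Y) by ring.
apply: ler_pM; rewrite ?divr_ge0 ?mulr_ge0//; try lra.
apply: ler_wpM2l; first exact: ltW.
by rewrite lef_pV2 ?posrE ?exprn_gt0 ?mulr_gt0//; nra.
Qed.

(** Any existing pair counts its own gap at least once. *)
Lemma gap_pairs_nil (E : seq R) : DG E = 0%N -> gap_pairs E = [::].
Proof.
move=> G0; case def: (gap_pairs E) => [//|x l].
have xE : x \in gap_pairs E by rewrite def mem_head.
have := gap_count_le_DG xE; rewrite G0 leqn0 gap_countE def /= eqxx.
by rewrite addn_eq0.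
Qed.

Lemma DG0_single (E : seq R) e : uniq E -> DG E = 0%N -> e \in E -> E = [:: e].
Proof.
move=> uE /gap_pairs_nil Enil eE.
have E1 e' : e' \in E -> e' = e.
  move=> e'E; apply/eqP; apply: contraT => ne.
  have : (e', e) \in gap_pairs E by rewrite mem_filter ne allpairs_f.
  by rewrite Enil.
case: E uE E1 {eE Enil} (eE) => [|a [|b l]] //= uE E1 _; first by rewrite (E1 a) ?mem_head.
by move: uE; rewrite (E1 a) ?mem_head// (E1 b) ?inE ?eqxx ?orbT.
Qed.

End Main.

Theorem theorem2 (R : realType) (n k : nat) (P : 'I_k -> 'M[R[i]]_n)
    (H : 'M[R[i]]_n) (E : seq R) (Pi : R -> 'M[R[i]]_n) (mu nu : 'I_k)
    (V : 'M[R[i]]_(n, \rank (P mu))) :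
  macro_decomposition P ->
  spectral_decomposition H E Pi ->
  isometry_onto V (P mu) ->
  forall eps delta : R, 0 < eps -> 0 < delta ->
  ((1 - eps)%:E <=
    unif_sphere V
      [set psi0 | most_times (fun t => (
          `| ((normsq (P nu *m (evol E Pi t *m psi0)))%:C)%C - Mcoef E Pi (P mu) (P nu) |
          <= ((4 * Num.sqrt (DE E Pi * (DG E)%:R / (delta * eps * (\rank (P mu))%:R)
                 * Num.min 1 ((\rank (P nu))%:R / (\rank (P mu))%:R)))%:C)%C)%R) delta])%E.
Proof.
move=> [Pp Pn0 PP _] [[_ uE] HPi PiPi Pi1 _] VP eps delta eps0 delta0.
have Pip e : e \in E -> orth_proj (Pi e) by move=> /HPi[].
have trP i : \tr (P i) = (\rank (P i))%:R by apply: mxtrace_idem; case: (Pp i).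
pose d := \rank (P mu); pose dnu := \rank (P nu).
have d0 : (0 < d)%N by rewrite lt0n mxrank_eq0.
have dnu0 : (0 < dnu)%N by rewrite lt0n mxrank_eq0.
have dR0 : 0 < d%:R :> R by rewrite ltr0n.
have dnuR0 : 0 < dnu%:R :> R by rewrite ltr0n.
pose M := Mval d (P mu) (P nu) E Pi.
have ME : Mcoef E Pi (P mu) (P nu) = M%:C%C.
  by rewrite /M (Mval_real _ (Pp mu) (Pp nu) Pip).
set K := 4 * Num.sqrt _.
have setE : forall (x : R), (`|x%:C%C - Mcoef E Pi (P mu) (P nu)| <= K%:C%C) = (`|x - M| <= K).
  by move=> x; rewrite ME -rmorphB normc_def /= expr0n addr0 sqrtr_sqr lecR.
(* An empty spectrum would make the identity matrix zero, contradicting [P mu != 0]. *)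
have [e eE] : exists e, e \in E.
  case: (E) Pi1 => [|e s _]; last by exists e; rewrite mem_head.
  rewrite big_nil => P1; have := Pn0 mu.
  by rewrite -[P mu]mulmx1 -P1 mulmx0 eqxx.
(* For [DG = 0] the claimed bound is 0, whereas Markov's inequality in time needs [K > 0]; equality
   is shown for every state and time instead. *)
have [G0|G0] := posnP (DG E).
  have Es := DG0_single uE G0 eE.
  have Pi_e : Pi e = 1%:M by move: Pi1; rewrite Es big_seq1.
  have dev0 : dev V (P mu) (P nu) E Pi = 0.
    rewrite devE// Es big_seq1 /eblock Pi_e mul1mx mulmx1.
    have [munu|mn] := eqVneq mu nu.
      have -> : adjmx V *m P nu *m V = 1%:M.
        rewrite -munu; case: VP => VV VVP.
        by have : adjmx V *m (V *m adjmx V) *m V = 1%:M;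
          [rewrite !mulmxA VV mul1mx VV|rewrite VVP].
      by rewrite mxtrace1 divff ?subrr// pnatr_eq0 -lt0n.
    have -> : adjmx V *m P nu *m V = 0.
      case: VP => VV VVP; have PmuV : V *m adjmx V *m V = V by rewrite -mulmxA VV mulmx1.
      rewrite VVP in PmuV; rewrite -mulmxA.
      suff -> : P nu *m V = 0 by rewrite mulmx0.
      by transitivity (P nu *m (P mu *m V)); [rewrite PmuV|rewrite mulmxA PP 1?eq_sym// mul0mx].
    by rewrite mxtrace0 mul0r sub0r -scalemx1 scale0r oppr0.
  apply: (@unif_sphere_ge R n d V _ (fun=> 0) 1) => //.
  - exact: cbmeas_cst.
  - rewrite /sphere_int /= Rintegral_cst ?mul0r; last exact: measurable_sphere_dom.
    by rewrite !mulr_ge0// ltW// leb_seq_fine_gt0.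
  move=> s Ds _; apply: most_times_all => // t /=; rewrite setE.
  have := @fluctE R n d V (P mu) (P nu) E Pi (Pp nu) uE Pip s t Ds; rewrite gap_pairs_nil//= big_seq1 dev0.
  rewrite qformE mulmx0 mul0mx mxE mul0r => /(congr1 (@complex.Re R))/= f0.
  by rewrite -/(fluct V (P mu) (P nu) E Pi s t) f0 normr0 mulr_ge0.
have DE1 : 1 <= DE E Pi.
  rewrite -lecR; apply: le_trans (tr_le_DE Pip eE).
  have [[PPe _] Pe0] := HPi e eE.
  by rewrite mxtrace_idem// ler1n lt0n mxrank_eq0.
have G1 : 1 <= (DG E)%:R :> R by rewrite ler1n.
(* [d * mn] is [min(d_mu, d_nu)]. *)
pose mn : R := Num.min 1 (dnu%:R / d%:R).
have mn0 : 0 < mn by rewrite lt_min ltr01 divr_gt0.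
have dmnE : (d%:R * mn = d%:R) /\ (d%:R * mn <= dnu%:R) \/ (d%:R * mn = dnu%:R).
  rewrite /mn; case: (leP 1 (dnu%:R / d%:R : R)) => h; [left|right]; last by field; rewrite gt_eqF.
  by rewrite mulr1; split=> //; move: h; rewrite ler_pdivlMr// mul1r.
have mP (z : R[i]) : z <= d%:R -> z <= dnu%:R -> z <= (d%:R * mn)%:C%C.
  by case: dmnE => [[-> _]|->]; rewrite rmorph_nat.
have X0 : 0 < DE E Pi * (DG E)%:R / (delta * eps * d%:R) * mn.
  rewrite !mulr_gt0 ?invr_gt0 ?mulr_gt0//; first exact: lt_le_trans DE1.
  exact: lt_le_trans G1.
have K0 : 0 < K by rewrite mulr_gt0// sqrtr_gt0.
have K2 : K ^+ 2 = 16 * (DE E Pi * (DG E)%:R / (delta * eps * d%:R) * mn).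
  by rewrite exprMn sqr_sqrtr ?(ltW X0)// -natrX.
pose F := fluct_bound V (P mu) (P nu) E Pi.
have F_ge0 s : 0 <= F s.
  rewrite addr_ge0 ?mulcJ_ge0// mulr_ge0 ?ler0n//.
  by apply: sumr_ge0 => x _; exact: mulcJ_ge0.
(* [delta K^2] is the mean square tolerated by the time estimate; multiplied by [eps] it is
   [16 DE DG m / d^2] with [m = d * mn], which dominates the spherical mean. *)
apply: (@unif_sphere_ge R n d V _ F (delta * K ^+ 2)) => //.
- by rewrite mulr_gt0// exprn_gt0.
- exact: cbmeas_fluct_bound.
- by move=> s; have := F_ge0 s; rewrite lecE => /andP[].
- have m0 : 0 <= (d%:R * mn)%:C%C :> R[i] by rewrite ler0c mulr_ge0// ltW.
  have HDE e' : e' \in E -> \tr (Pi e') <= (DE E Pi)%:C%C by exact: tr_le_DE.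
  have h1 : hs (\sum_(e <- E) eblock V (P nu) Pi e e) <= (d%:R * mn)%:C%C.
    apply: mP; first exact: hs_diag_le_dmu (Pp nu) VP uE Pip PiPi Pi1.
    by rewrite -trP; exact: hs_diag_le_dnu (Pp nu) VP uE Pip PiPi Pi1.
  have h2 : \sum_(e <- E) \sum_(e' <- E) hs (eblock V (P nu) Pi e e') <= (d%:R * mn)%:C%C.
    apply: mP; first exact: sum_hs_le_dmu (Pp nu) VP Pip Pi1.
    by rewrite -trP; exact: sum_hs_le_dnu (Pp nu) VP Pip Pi1.
  have D0 : 0 < (DE E Pi)%:C%C :> R[i] by rewrite ltcR (lt_le_trans ltr01).
  have h3 : \sum_(e <- E) \sum_(e' <- E) \tr (eblock V (P nu) Pi e e') *
      conjc (\tr (eblock V (P nu) Pi e e')) <= (DE E Pi)%:C%C * (d%:R * mn)%:C%C.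
    rewrite mulrC -ler_pdivrMr//; apply: mP; rewrite ler_pdivrMr// mulrC -trP.
      exact: sum_tr_le_dmu (Pp nu) VP Pip Pi1 _ HDE.
    exact: sum_tr_le_dnu (Pp nu) VP Pip Pi1 _ HDE.
  have := sphere_int_fluct_bound_le (Pp mu) (Pp nu) VP Pip d0 m0 h1 h2 h3.
  rewrite -(rmorph_nat (real_complex R)) -!rmorphM -!rmorphD -!rmorphM -!rmorphD -!rmorphM /=.
  rewrite lecE => /andP[_ /= H1]; apply: le_trans H1 _.
  rewrite K2 natrM -natr1.
  have v0 : 0 < fine (@leb_seq R (2 * d) (sphere_dom d)) by exact: leb_seq_fine_gt0.
  have d1 : 1 <= d%:R :> R by rewrite ler1n.
  have mm : 0 <= d%:R * mn by rewrite mulr_ge0// ltW.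
  apply: le_trans (typicality_arith v0 d1 DE1 G1 mm) _.
  rewrite le_eqVlt; apply/orP; left; apply/eqP; congr (_ * _).
  by field; rewrite !gt_eqF.
- move=> s Ds Fs /=.
  have := most_times_fluct (Pp nu) uE Pip Ds K0 (ltW Fs).
  rewrite /fluct -/M; congr (most_times _ delta).
  by apply/funext => t; apply/propext; rewrite setE.
Qed.
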